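(* Let $p,q\in\mathbb N_1$ with $p\le q$ and let $g\colon[q]\to[p]$ be surjective. If the $q$-chromatic partition structure $P_\bullet=(P_n)_n$ is represented by the Borel probability measure $\mu$ on $\boldsymbol\nabla^{(q)}_0$ (i.e. $P_n[A]=\int\psi_A\,d\mu$ for all $n\in\mathbb N_0$, $A\in\mathcal A^{(q)}_n$), then the $p$-chromatic partition structure $(g^{\deg})_\sharp P_\bullet=((g^{\deg})_\sharp P_n)_n$ is represented by the push-forward $(G_g)_\sharp\mu$. In particular, $(g^{\deg})_\sharp$ maps extremal $q$-chromatic partition structures to extremal $p$-chromatic partition structures, namely $$(g^{\deg})_\sharp\,\psi_\bullet(\mathbf x)=\psi_\bullet(G_g(\mathbf x)),\qquad \mathbf x\in\boldsymbol\nabla^{(q)}_0 .$$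
   Context: Notation: $\mathbb N_1=\{1,2,\dots\}$, $\mathbb N_0=\{0,1,\dots\}$, $[q]=\{1,\dots,q\}$, $\mathbb N^q_*=\mathbb N_0^q\setminus\{\mathbf 0\}$, $0^0=1$; $|\mathbf a|=\sum_j|a_j|$, $\mathbf a!=\prod_ja_j!$, $\mathbf x^{\mathbf a}=\prod_jx_j^{a_j}$; $\mathbf e_j$ canonical basis vectors. A $q$-chromatic partition of $n$ is a finitely supported map $A\colon\mathbb N^q_*\to\mathbb N_0$ with $\sum_{\mathbf a}A(\mathbf a)|\mathbf a|=n$; $\mathcal A^{(q)}_n$ is the set of these ($\mathcal A^{(q)}_0=\{0\}$); $\mathbf 1_{\mathbf a}$ is the multiset with single element $\mathbf a$; operations, $\le$ pointwise; $s(A)=\sum_{\mathbf a} A(\mathbf a)$. A $q$-chromatic partition structure is a sequence $(P_n)_{n\ge0}$ of probability measures on $\mathcal A^{(q)}_n$ with $P_{n-1}[B]=\sum_{A\in\mathcal A^{(q)}_n}P_n[A]S_{n-1,n}(A,B)$, $n\ge1$, where $S_{n-1,n}(A,B)=a_jA(\mathbf a)/n$ if $B=A_{\setminus\mathbf a,j}$ for some $\mathbf a\in\mathrm{supp}A$, $a_j\ge1$, and $0$ otherwise; $A_{\setminus\mathbf a,j}=A-\mathbf 1_{\mathbf a}$ if $\mathbf a=\mathbf e_j$, else $A-\mathbf 1_{\mathbf a}+\mathbf 1_{\mathbf a-\mathbf e_j}$. Kingman simplex: $\mathbf s<_{\mathrm{sl}}\mathbf t$ iff $(|\mathbf s|,s_1,\dots,s_q)<(|\mathbf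 t|,t_1,\dots,t_q)$ lexicographically. $\boldsymbol\nabla^{(q)}_0$ is the set of sequences $\mathbf x=(\mathbf x_i)_{i\ge0}$ in $[0,\infty)^q$ with $\mathbf x_i\ge_{\mathrm{sl}}\mathbf x_{i+1}$ for $i\ge1$, $\sum_{i\ge0}|\mathbf x_i|=1$, with the Borel $\sigma$-algebra of the product topology. For $A\in\mathcal A^{(q)}_n$ let $(\mathbf a_h)_{h\in[s(A)]}$ list all $\mathbf a\in\mathrm{supp}A$ with multiplicity $A(\mathbf a)$, decreasingly in shortlex order; $T_r$ is the set of injective maps $[r]\to\mathbb N_1$ ($T_0=\{\varnothing\}$). $\varphi_0\equiv1$, $\varphi_A(\mathbf x)=n!\big(\prod_{\mathbf a\in\mathrm{supp}A}\frac1{\mathbf a!^{A(\mathbf a)}A(\mathbf a)!}\big)\sum_{\iota\in T_{s(A)}}\prod_{h=1}^{s(A)}\mathbf x_{\iota(h)}^{\mathbf a_h}$; with $\mathrm{dust}(\mathbf m)=\sum_jm_j\mathbf 1_{\mathbf e_j}$: $\psi_0\equiv1$, $\psi_A(\mathbf x)=n!\sum_{\mathbf m\in\mathbb N_0^q,\,\mathrm{dust}(\mathbf m)\le A}\frac{\mathbf x_0^{\mathbf m}}{\mathbf m!(n-|\mathbf m|)!}\varphi_{A-\mathrm{dust}(\mathbf m)}(\mathbf x)$. For each $\mathbf x$, $\psi_\bullet(\mathbf x)=(A\mapsto\psi_A(\mathbf x))$ is the $q$-chromatic partition structure represented by $\delta_{\mathbf x}$; these are the extremal ones. Degeneracy maps: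 $g_\sharp\colon[0,\infty)^q\to[0,\infty)^p$, $(g_\sharp\mathbf v)_k=\sum_{j\in g^{-1}(k)}v_j$; $g^{\deg}\colon\mathcal A^{(q)}_n\to\mathcal A^{(p)}_n$, $g^{\deg}(A)=\sum_{\mathbf a\in\mathrm{supp}A}A(\mathbf a)\mathbf 1_{g_\sharp\mathbf a}$; $(g^{\deg})_\sharp$ is push-forward of measures. Lifted degeneracy map $G_g\colon\boldsymbol\nabla^{(q)}_0\to\boldsymbol\nabla^{(p)}_0$: $G_g(\mathbf x)_0=g_\sharp\mathbf x_0$, and $(G_g(\mathbf x)_i)_{i\ge1}$ is the rearrangement of $(g_\sharp\mathbf x_i)_{i\ge1}$ in decreasing shortlex order. *)

(* Defs.v *)
From HB Require Import structures.
From mathcomp Require Import all_boot all_order all_algebra.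
From mathcomp Require Import finmap multiset.
From mathcomp Require Import all_classical all_reals all_analysis.
Set Implicit Arguments.
Unset Strict Implicit.
Unset Printing Implicit Defensive.
Import Order.TTheory GRing.Theory Num.Theory.
Import numFieldNormedType.Exports.
Local Open Scope classical_set_scope.
Local Open Scope ring_scope.

(* Vectors of N_0^q are 'rV[nat]_q and vectors of [0, oo[^q are 'rV[R]_q with
   nonnegative entries, so the sum of the entries is the l^1 norm. *)
Definition vnorm (V : nmodType) q (v : 'rV[V]_q) : V := \sum_j v 0 j.

Definition slkey (V : nmodType) q (v : 'rV[V]_q) : seq V :=
  vnorm v :: [seq v 0 j | j <- enum 'I_q].

Definition lexi_le d (T : orderType d) (s t : seq T) : bool :=
  ((s : seqlexi T) <= (t : seqlexi T))%O.

Notation "u <=sl v" := (lexi_le (slkey u) (slkey v)) (at level 70).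

Definition g_sharp (V : nmodType) q p (g : 'I_q -> 'I_p) (v : 'rV[V]_q) :
  'rV[V]_p := \row_k \sum_(j | g j == k) v 0 j.

Notation multicolor q := {mset 'rV[nat]_q}%mset.

Definition weight q (A : multicolor q) : nat :=
  (\sum_(a <- finsupp A) A a * vnorm a)%N.

Definition nparts q (A : multicolor q) : nat := (\sum_(a <- finsupp A) A a)%N.

(* A map on N^q_* is encoded as a map on N_0^q vanishing at 0. *)
Definition is_chromatic q (n : nat) (A : multicolor q) : bool :=
  (A 0 == 0%N) && (weight A == n).

Record chrom q (n : nat) := Chrom {
  multiset_of_chrom :> multicolor q ;
  _ : is_chromatic n multiset_of_chrom }.

HB.instance Definition _ q n := [isSub for @multiset_of_chrom q n].
HB.instance Definition _ q n := [Choice of chrom q n by <:].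

Definition unitv q (j : 'I_q) : 'rV[nat]_q := \row_i (i == j : nat).

Definition subv q (a b : 'rV[nat]_q) : 'rV[nat]_q :=
  \row_i (a ord0 i - b ord0 i)%N.

(* A_{\ a, j} *)
Definition drop_ball q (A : multicolor q) (a : 'rV[nat]_q) (j : 'I_q) :
    multicolor q :=
  if a == unitv j then msetB A (msetn 1 a)
  else msetD (msetB A (msetn 1 a)) (msetn 1 (subv a (unitv j))).

(* S_{n-1, n}(A, B) with n = weight A; the pair (a, j) with B = A_{\ a, j} is
   unique if it exists, so the value does not depend on the choice of [pick]. *)
Definition sampling (R : realType) q (A B : multicolor q) : R :=
  match [pick u : finsupp A * 'I_q |
      (0 < (val u.1 : 'rV[nat]_q) ord0 u.2)%N
      && (B == drop_ball A (val u.1) u.2)] with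
  | Some u =>
      ((val u.1 : 'rV[nat]_q) ord0 u.2 * A (val u.1))%N%:R / (weight A)%:R
  | None => 0
  end.

Lemma weightE q (A : multicolor q) :
  weight A = (\sum_(a <- enum_mset A) vnorm a)%N.
Proof. by rewrite sum_mset. Qed.

Lemma weightD q (A B : multicolor q) :
  weight (msetD A B) = (weight A + weight B)%N.
Proof.
rewrite !weightE -big_cat; apply: perm_big; apply/allP => a _ /=.
by rewrite count_cat !count_mem_mset msetE2.
Qed.

Lemma weight0 q : weight (mset0 : multicolor q) = 0%N.
Proof. by rewrite /weight finsupp0 big_seq_fset0. Qed.

Lemma weight_msetn q n (a : 'rV[nat]_q) :
  weight (msetn n a) = (n * vnorm a)%N.
Proof. by rewrite weightE enum_msetn big_nseq iter_addn addn0 mulnC. Qed.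

Lemma vnorm_g_sharp (V : nmodType) q p (g : 'I_q -> 'I_p) (v : 'rV[V]_q) :
  vnorm (g_sharp g v) = vnorm v.
Proof.
rewrite /vnorm [RHS](partition_big g predT)//=.
by apply: eq_bigr => k _; rewrite mxE.
Qed.

Lemma vnorm_eq0 q (a : 'rV[nat]_q) : (vnorm a == 0%N) = (a == 0).
Proof.
apply/idP/eqP => [|->].
  rewrite /vnorm (big_morph id (id1 := 0%N) (op1 := addn))//.
  rewrite sum_nat_eq0 => /forallP a0; apply/rowP => j; rewrite mxE.
  by apply/eqP; have := a0 j.
by rewrite /vnorm big1// => j _; rewrite mxE.
Qed.

Lemma chrom_point_subproof q n :
  is_chromatic n (msetn n (unitv (ord0 : 'I_q.+1))).
Proof.
have v1 : vnorm (unitv (ord0 : 'I_q.+1)) = 1%N.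
  by rewrite /vnorm (bigD1 ord0)//= mxE eqxx big1 ?addr0// => i /negPf;
    rewrite mxE => ->.
have u0 : (0 == unitv (ord0 : 'I_q.+1)) = false.
  by rewrite eq_sym -vnorm_eq0 v1.
by rewrite /is_chromatic weight_msetn v1 muln1 eqxx msetnE u0.
Qed.

(* Measurable types are pointed, hence inhabited, so the measure-theoretic
   notions are stated for q.+1 colours. *)
HB.instance Definition _ q n := isPointed.Build (chrom q.+1 n)
  (Chrom (chrom_point_subproof q n)).
HB.instance Definition _ q n :=
  @isMeasurable.Build default_measure_display (chrom q.+1 n)
    discrete_measurable discrete_measurable0
    discrete_measurableC discrete_measurableU.

Definition partition_structure (R : realType) q
    (P : forall n : nat, probability (chrom q.+1 n) R) : Prop :=
  forall n (B : chrom q.+1 n),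
    P n [set B] =
    (\sum_(A \in [set: chrom q.+1 n.+1]) P n.+1 [set A] * (sampling R A B)%:E)%E.

(* Extreme point of the convex set of partition structures. *)
Definition extremal (R : realType) q
    (P : forall n : nat, probability (chrom q.+1 n) R) : Prop :=
  partition_structure P /\
  forall (P1 P2 : forall n : nat, probability (chrom q.+1 n) R) (t : R),
    partition_structure P1 -> partition_structure P2 -> 0 < t < 1 ->
    (forall n E, P n E = t%:E * P1 n E + (1 - t)%:E * P2 n E)%E ->
    forall n E, P1 n E = P n E /\ P2 n E = P n E.

Definition gdeg_mset q p (g : 'I_q -> 'I_p) (A : multicolor q) : multicolor p :=
  \big[@msetD _/@mset0 _]_(a <- finsupp A) msetn (A a) (g_sharp g a).

Lemma gdeg_subproof q p (g : 'I_q -> 'I_p) n (A : chrom q n) :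
  is_chromatic n (gdeg_mset g A).
Proof.
case: A => A /= /andP[/eqP A0 /eqP <-]; apply/andP; split; last first.
  rewrite /gdeg_mset (big_morph _ (@weightD _) (@weight0 _)).
  by apply/eqP/eq_bigr => a _; rewrite weight_msetn vnorm_g_sharp.
rewrite /gdeg_mset.
rewrite (big_morph (fun B : multicolor p => B 0) (id1 := 0%N) (op1 := addn)).
- rewrite big_seq big1// => a aA; rewrite msetnE eq_sym -vnorm_eq0.
  rewrite vnorm_g_sharp vnorm_eq0; case: eqP => // a0.
  by move: aA; rewrite mem_finsupp a0 A0.
- by move=> B C; rewrite msetE2.
- by rewrite mset0E.
Qed.

Definition gdeg q p (g : 'I_q -> 'I_p) n (A : chrom q n) : chrom p n :=
  Chrom (gdeg_subproof g A).

HB.instance Definition _ q p (g : 'I_q.+1 -> 'I_p.+1) n :=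
  @isMeasurableFun.Build _ _ (chrom q.+1 n) (chrom p.+1 n) (@gdeg _ _ g n)
    (fun _ _ _ => I).

Definition gdeg_push (R : realType) q p (g : 'I_q.+1 -> 'I_p.+1)
    (P : forall n : nat, probability (chrom q.+1 n) R) n :
    probability (chrom p.+1 n) R :=
  distribution (P n) (@gdeg _ _ g n).

(* x 0 is the dust component and is exempt from the ordering condition. *)
Definition kingman_simplex (R : realType) q : set {ptws nat -> 'rV[R]_q} :=
  [set x : nat -> 'rV[R]_q | [/\ forall i j, 0 <= x i ord0 j,
               forall i, x i.+2 <=sl x i.+1 &
               (\sum_(0 <= i <oo) (vnorm (x i))%:E = 1)%E]].

Arguments kingman_simplex R q : clear implicits.

Definition simplex (R : realType) q : Type :=
  set_type (kingman_simplex R q.+1).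

HB.instance Definition _ (R : realType) q := Topological.on (simplex R q).

Lemma simplex_point_subproof (R : realType) q :
  (fun i => if i is 0%N then delta_mx 0 0 else 0) \in kingman_simplex R q.+1.
Proof.
rewrite inE; split => [[|i] j|i|]; rewrite ?mxE ?ler0n ?lexx//.
  exact: (@Order.le_refl _ (seqlexi R)).
rewrite nneseries_recl//=; last first.
  move=> i _; rewrite lee_fin sumr_ge0// => j _.
  by case: i => [|i]; rewrite mxE ?ler0n.
rewrite eseries0 ?adde0.
  rewrite /vnorm (bigD1 0)//= mxE !eqxx big1 ?addr0// => i /negPf i0.
  by rewrite mxE i0 andbF.
by case=> [|i] // _ _; rewrite /vnorm big1// => j _; rewrite mxE.
Qed.

HB.instance Definition _ (R : realType) q := isPointed.Build (simplex R q)
  (SigSub (simplex_point_subproof R q)).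

HB.instance Definition _ (R : realType) q :=
  @isMeasurable.Build (sigma_display (@open (simplex R q))) (simplex R q)
    <<s @open (simplex R q) >> (@sigma_algebra0 _ setT _) (@sigma_algebraC _ _)
    (@sigma_algebra_bigcup _ setT _).

Definition vfact q (a : 'rV[nat]_q) : nat := (\prod_j (a ord0 j)`!)%N.

Definition vpow (R : realType) q (v : 'rV[R]_q) (a : 'rV[nat]_q) : R :=
  \prod_j v ord0 j ^+ a ord0 j.

Definition parts q (A : multicolor q) : seq 'rV[nat]_q :=
  sort (fun a b : 'rV[nat]_q => b <=sl a) (enum_mset A).

Definition inj_maps r : set {ffun 'I_r -> nat} :=
  [set iota : {ffun 'I_r -> nat} | injective iota /\ forall h, (0 < iota h)%N].

Arguments inj_maps r : clear implicits.

(* Extended-real valued, since the sum over injective maps is infinite. *)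
Definition phi (R : realType) q (x : nat -> 'rV[R]_q) (A : multicolor q) :
    \bar R :=
  (((weight A)`!%:R
    * \prod_(a <- finsupp A) ((vfact a ^ A a * (A a)`!)%N%:R)^-1)%:E
   * \esum_(iota in inj_maps (nparts A))
       (\prod_(h < nparts A) vpow (x (iota h)) (nth 0 (parts A) h))%:E)%E.

Definition dust q (m : 'rV[nat]_q) : multicolor q :=
  \big[@msetD _/@mset0 _]_j msetn (m ord0 j) (unitv j).

Definition psi (R : realType) q (x : nat -> 'rV[R]_q) (A : multicolor q) :
    \bar R :=
  ((weight A)`!%:R%:E
   * \sum_(m \in [set m | msubset (dust m) A])
       ((vpow (x 0%N) m / ((vfact m)%:R * (weight A - vnorm m)`!%:R))%:E
        * phi x (msetB A (dust m))))%E.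

(* psi_n(x) as a set function, i.e. with mass psi_A(x) at each A. *)
Definition psi_law (R : realType) q (x : simplex R q) n
    (E : set (chrom q.+1 n)) : \bar R := (\sum_(A \in E) psi (val x) A)%E.

Definition represents (R : realType) q (mu : set (simplex R q) -> \bar R)
    (P : forall n : nat, probability (chrom q.+1 n) R) : Prop :=
  forall n (A : chrom q.+1 n),
    P n [set A] = (\int[mu]_x psi (val x) A)%E.

Lemma wo_nat_enum (prec : rel nat) :
  irreflexive prec -> transitive prec ->
  (forall i j, [\/ prec i j, i = j | prec j i]) ->
  (forall j, exists N, forall i, prec i j -> (i < N)%N) ->
  exists2 sigma : nat -> nat, bijective sigma &
    forall i, prec (sigma i) (sigma i.+1).
Proof.
move=> irr tr tot /choice[N NP].
pose cnt j M := count (prec^~ j) (iota 0 M).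
have cntE j M : (N j <= M)%N -> cnt j M = cnt j (N j).
  move=> /subnKC <-; rewrite /cnt iotaD count_cat -[RHS]addn0; congr addn.
  rewrite add0n; apply/eqP; rewrite -leqn0 leqNgt -has_count -all_predC.
  apply/allP => i; rewrite mem_iota => /andP[Ni _] /=.
  by apply/negP => /NP; rewrite ltnNge Ni.
pose rk j := cnt j (N j).
have rk_lt i j : prec i j -> (rk i < rk j)%N.
  move=> ij; pose M := maxn (N i) (maxn (N j) i.+1).
  rewrite /rk -(@cntE i M) ?leq_max ?leqnn// -(@cntE j M); last first.
    by rewrite !leq_max leqnn orbT.
  have -> : (cnt i M).+1 = count (predU (pred1 i) (prec^~ i)) (iota 0 M).
    rewrite -add1n -[cnt i M]/(count _ _) -[1%N]/(nat_of_bool true).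
    have -> : true = (i \in iota 0 M).
      by rewrite mem_iota add0n !leq_max leqnn !orbT.
    rewrite -count_uniq_mem ?iota_uniq// -count_predUI.
    rewrite [X in (_ + X)%N](_ : _ = 0%N) ?addn0//.
    apply/eqP; rewrite -leqn0 leqNgt -has_count -all_predC.
    by apply/allP => l _ /=; apply/negP => /andP[/eqP ->]; rewrite irr.
  apply: sub_count => l /= /orP[/eqP -> //|li]; exact: tr li ij.
have rk_inj : injective rk.
  move=> i j; case: (tot i j) => // /rk_lt + e; by rewrite e ltnn.
have rk_pred j n : (n < rk j)%N -> exists i, rk i = (rk j).-1.
  move=> nj; have nmax s : s != [::] ->
      exists2 i, i \in s & forall l, l \in s -> l = i \/ prec l i.
    elim: s => // a [_ _|b s /(_ isT)[i is_ imax] _].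
      by exists a; rewrite ?mem_head// => l; rewrite inE => /eqP; left.
    case: (tot a i) => [ai|ai|ia].
    - exists i; first by rewrite in_cons is_ orbT.
      move=> l; rewrite in_cons => /orP[/eqP ->|/imax//]; by right.
    - exists i; first by rewrite in_cons is_ orbT.
      move=> l; rewrite in_cons => /orP[/eqP ->|/imax//]; by left.
    - exists a; rewrite ?mem_head// => l.
      rewrite in_cons => /orP[/eqP ->|/imax[->|li]]; [by left|by right|].
      by right; exact: tr li ia.
  pose s := [seq i <- iota 0 (N j) | prec i j].
  have [|i] := nmax s.
    by rewrite -size_eq0 size_filter -lt0n (leq_ltn_trans _ nj).
  rewrite mem_filter => /andP[ij _] imax; exists i.
  have rj0 : (0 < rk j)%N by exact: leq_ltn_trans nj.
  suff : (rk j <= (rk i).+1)%N.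
    move=> ji; apply/eqP; rewrite -eqSS prednK// eqn_leq ji andbT.
    exact: rk_lt.
  pose M := maxn (N i) (N j).
  rewrite /rk -(@cntE i M) ?leq_max ?leqnn// -(@cntE j M) ?leq_max ?leqnn ?orbT//.
  apply: (@leq_trans (count (predU (pred1 i) (prec^~ i)) (iota 0 M))).
    apply: sub_count => l /= lj.
    have : l \in s by rewrite mem_filter lj mem_iota /= add0n NP.
    by move=> /imax[->|->]; rewrite ?eqxx ?orbT.
  apply: leq_trans (_ : count (pred1 i) (iota 0 M) + cnt i M <= _)%N.
    by rewrite -count_predUI leq_addr.
  by rewrite count_uniq_mem ?iota_uniq// -add1n leq_add2r leq_b1.
have rk_surj n : exists j, rk j = n.
  have [j nj] : exists j, (n <= rk j)%N.
    apply/not_existsP => nle.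
    have bd (j : 'I_n.+1) : (rk j < n)%N by rewrite ltnNge; apply/negP/nle.
    have : injective (fun j : 'I_n.+1 => Ordinal (bd j)).
      by move=> a b [] /rk_inj /val_inj.
    by move=> /leq_card; rewrite !card_ord ltnn.
  have [m ej] : exists m, rk j = m by exists (rk j).
  elim: m j ej nj => [|m IH] j ej nj.
    by exists j; apply/eqP; rewrite ej eq_sym -leqn0 -ej.
  move: nj; rewrite leq_eqVlt => /orP[/eqP ->|nm]; first by exists j.
  have [i ri] := @rk_pred j n nm.
  by apply: (IH i); rewrite ri ej// -ltnS -ej.
have [sigma sP] := choice rk_surj.
exists sigma; first by exists rk => // j; apply: rk_inj.
move=> i; case: (tot (sigma i) (sigma i.+1)) => // [e|/rk_lt].
  by have := sP i; rewrite e sP => /eqP; rewrite eqn_leq ltnn.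
by rewrite !sP ltnNge leqnSn.
Qed.

(* (y_i)_{i >= 1} is a rearrangement of (g_sharp x_i)_{i >= 1}; for y in the
   simplex it is the one in decreasing shortlex order. *)
Definition is_lift (R : realType) q p (g : 'I_q -> 'I_p)
    (x : nat -> 'rV[R]_q) (y : nat -> 'rV[R]_p) : Prop :=
  y 0%N = g_sharp g (x 0%N) /\
  exists2 sigma : nat -> nat, bijective sigma &
    forall i, y i.+1 = g_sharp g (x (sigma i).+1).

Lemma sl_vnorm (R : realType) q (u v : 'rV[R]_q) :
  u <=sl v -> vnorm u <= vnorm v.
Proof. by rewrite /lexi_le/= lexi_cons => /andP[]. Qed.

Lemma simplex_vnorm_le (R : realType) q (x : simplex R q) i j :
  (i <= j)%N -> vnorm (val x j.+1) <= vnorm (val x i.+1).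
Proof.
case: x => x /=; rewrite inE => -[_ xS _].
elim: j => [|j IH]; first by rewrite leqn0 => /eqP ->.
rewrite leq_eqVlt => /orP[/eqP ->//|]; rewrite ltnS => /IH.
exact/le_trans/sl_vnorm.
Qed.

Lemma simplex_vnorm_bound (R : realType) q (x : simplex R q) i :
  i.+1%:R * vnorm (val x i.+1) <= 1.
Proof.
have xle := @simplex_vnorm_le R q x.
case: x xle => x /=; rewrite inE => -[x0 _ x1] xle.
have vx0 k : 0 <= vnorm (x k) by apply: sumr_ge0.
rewrite -lee_fin -x1.
apply: le_trans (@nneseries_lim_ge R _ predT 0%N i.+2 _); last first.
  by move=> k _ _; rewrite lee_fin.
rewrite sumEFin lee_fin big_mkord big_ord_recl/= -[leLHS]add0r lerD//.
rewrite mulr_natl -[X in _ *+ X](card_ord i.+1) -sumr_const ler_sum// => k _.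
by apply: (xle k i); rewrite -ltnS.
Qed.

Lemma lift_exists (R : realType) q p (g : 'I_q.+1 -> 'I_p.+1)
  (x : simplex R q) : exists y : simplex R p, is_lift g (val x) (val y).
Proof.
pose v i := g_sharp g (val x i.+1).
have vE i : vnorm (v i) = vnorm (val x i.+1) by rewrite vnorm_g_sharp.
pose k i : seqlexi R := slkey (v i).
pose prec i j := (k j < k i)%O || (k i == k j) && (i < j)%N.
have g0 (u : 'rV[R]_q.+1) : (forall j, 0 <= u ord0 j) ->
    forall j, 0 <= (g_sharp g u) ord0 j.
  by move=> u0 j; rewrite mxE; apply: sumr_ge0 => i _; exact: u0.
have [x0 _ x1] : kingman_simplex R q.+1 (val x).
  by case: x {v vE k prec} => x /=; rewrite inE.
have irr : irreflexive prec by move=> i; rewrite /prec ltxx ltnn andbF.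
have tr : transitive prec.
  move=> j i l /orP[ji|/andP[/eqP ij lt_ij]] /orP[lj|/andP[/eqP jl lt_jl]].
  - by rewrite /prec (lt_trans lj ji).
  - by rewrite /prec -jl ji.
  - by rewrite /prec ij lj.
  - by rewrite /prec ij jl eqxx (ltn_trans lt_ij lt_jl) orbT.
have tot i j : [\/ prec i j, i = j | prec j i].
  case: (ltgtP (k i) (k j)) => [ij|ji|ij].
  - by apply: Or33; rewrite /prec ij.
  - by apply: Or31; rewrite /prec ji.
  - case: (ltngtP i j) => [lt|lt|->]; last exact: Or32.
    + by apply: Or31; rewrite /prec ij eqxx lt orbT.
    + by apply: Or33; rewrite /prec ij eqxx lt orbT.
have precle i j : prec i j -> vnorm (v j) <= vnorm (v i).
  move=> ij; apply: sl_vnorm; rewrite -[_ <=sl _]/((k j <= k i)%O).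
  by move: ij => /orP[/ltW//|/andP[/eqP ->]].
have fin j : exists N, forall i, prec i j -> (i < N)%N.
  have : 0 <= vnorm (v j) by rewrite vE; apply: sumr_ge0.
  rewrite le_eqVlt => /orP[/eqP vj|vj].
    exists j => i ij; rewrite ltnNge; apply/negP => ji.
    have vi : vnorm (v i) = 0.
      apply/eqP; rewrite eq_le; apply/andP; split.
        by rewrite vj !vE simplex_vnorm_le.
      by rewrite vE; apply: sumr_ge0.
    have v0 l : vnorm (v l) = 0 -> v l = 0.
      rewrite /vnorm => /psumr_eq0P vl; apply/rowP => a; rewrite [RHS]mxE.
      by apply: vl => // b _; exact: g0.
    move: ij; rewrite /prec /k (v0 i vi) (v0 j (esym vj)) ltxx eqxx/=.
    by rewrite ltnNge ji.
  exists (Num.truncn (vnorm (v j))^-1).+1 => i /precle ij.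
  rewrite ltnS; apply: leq_trans (leqnSn i) _.
  rewrite -(@natrK R i.+1); apply: le_truncn.
  rewrite -[leRHS]mul1r ler_pdivlMr//.
  by apply: le_trans (simplex_vnorm_bound x i); rewrite ler_wpM2l// -vE.
have [sigma sbij sprec] := wo_nat_enum irr tr tot fin.
pose y i := if i is i'.+1 then v (sigma i') else g_sharp g (val x 0%N).
have yS : y \in kingman_simplex R p.+1.
  rewrite inE; split.
  - by case=> [|i] j; apply: g0.
  - move=> i; rewrite /= -[_ <=sl _]/((k (sigma i.+1) <= k (sigma i))%O).
    by have := sprec i => /orP[/ltW//|/andP[/eqP ->]].
  - pose t i := if i is i'.+1 then (sigma i').+1 else 0%N.
    have tbij : set_bij setT setT t.
      case: sbij => s1 s1K s1K'; split => //.
      + by move=> [|a] [|b] _ _ //= [] /(can_inj s1K) ->.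
      + by move=> [|b] _ /=; [exists 0%N | exists (s1 b).+1; rewrite //= s1K'].
    rewrite -[RHS]x1 !nneseries_esumT; last 2 first.
    + by move=> n; rewrite lee_fin; apply: sumr_ge0.
    + by move=> [|n]; rewrite lee_fin; apply: sumr_ge0 => j _; apply: g0.
    rewrite [RHS](reindex_esum _ _ _ _ tbij); apply: eq_esum => -[|i] _ /=.
      by rewrite vnorm_g_sharp.
    by rewrite vE.
exists (SigSub yS); split => //.
by exists sigma.
Qed.

Definition lift_deg (R : realType) q p (g : 'I_q.+1 -> 'I_p.+1)
    (x : simplex R q) : simplex R p :=
  sval (cid (lift_exists g x)).

(* Main.v *)
Require Import Defs.
From HB Require Import structures.
From mathcomp Require Import all_boot all_order all_algebra.
From mathcomp Require Import fingroup perm.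
From mathcomp Require Import ring.
From mathcomp Require Import finmap multiset.
From mathcomp Require Import all_classical all_reals all_analysis.
From mathcomp Require Import measurable_realfun.

(** Merging colours commutes with sampling and with [psi], and decompositions of
the image of a partition structure lift through it; the three claims follow.

- Merging commutes with discarding a uniformly chosen ball
  ([sampling_gdeg]): the image of the multiset left after discarding a ball
  of colour [j] from a part [a] is what is left after discarding a ball of
  colour [g j] from the part [g_sharp g a].  Hence [gdeg_push] preserves
  partition structures.

- Merging commutes with [psi] ([psi_lift]).  Up to the factor [n!], [psi] is
  a sum of products of divided powers [v^a / a!], and the multinomial theorem
  says that the divided power of [g_sharp g v] of exponent [b] is the sum of
  those of [v] over all exponents [c] with [g_sharp g c = b].  Applied to each
  part this expresses the sum over injective maps at [g_sharp g x] through
  sequences of exponents [M] lying above a fixed sequence; [sum_lifts] counts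
  how many of these sequences have a given multiset of entries, and the count
  is exactly the quotient of the normalizing factorials of [phi].  The dust
  part splits off as a product, and the rearrangement of the boxes by
  [lift_deg] permutes the injective maps.  Integrating this identity gives the
  statement on representing measures, once [lift_deg] is known to be
  measurable: the entry of rank [i] of the rearranged sequence is picked by
  counting how many entries are larger, a countable Boolean combination of
  measurable comparisons ([sorted_rank]).

- Merging preserves extremality ([extremal_gdeg_push]).  This does not go
  through the description of the extremal structures by points of the simplex.
  It is enough to lift decompositions: if a [p]-chromatic structure [r] satisfies
  [t * r <= gdeg_push g P], there is a [q]-chromatic structure [m1] above [r]
  with [t * m1 <= P] ([lift_pmass]).  Extremality of [P] forces [m1] to be [P],
  so [r] is its image.  To build [m1], reweight [P] at a large size [k] by the
  density of [r] with respect to the image of [P], sample down to all smaller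
  sizes, and let [k] tend to infinity along an ultrafilter; every property
  needed is a closed condition on finitely many values. *)

Set Implicit Arguments.
Unset Strict Implicit.
Unset Printing Implicit Defensive.
Import Order.TTheory GRing.Theory Num.Theory.
Import numFieldNormedType.Exports.
Local Open Scope classical_set_scope.
Local Open Scope ring_scope.

(** * Vectors and multisets under merging of colours *)

Lemma perm_msetD (K : choiceType) (A B : {mset K}%mset) :
  perm_eq (enum_mset (msetD A B)) (enum_mset A ++ enum_mset B).
Proof.
by apply/allP => a _ /=; rewrite count_cat !count_mem_mset msetE2.
Qed.

Lemma sum_finsupp_mset (K : choiceType) (A : {mset K}%mset) (F : K -> nat) :
  (\sum_(a <- finsupp A) A a * F a = \sum_(a <- enum_mset A) F a)%N.
Proof. by rewrite sum_mset. Qed.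

Lemma gdeg_msetE q p (g : 'I_q -> 'I_p) (A : multicolor q) b :
  gdeg_mset g A b = (\sum_(a <- enum_mset A) (g_sharp g a == b))%N.
Proof.
rewrite -sum_finsupp_mset /gdeg_mset.
rewrite (big_morph (fun B : multicolor p => B b) (id1 := 0%N) (op1 := addn)).
- by apply: eq_bigr => a _; rewrite msetnE eq_sym; case: eqP => _;
  rewrite ?muln1 ?muln0.
- by move=> B C; rewrite msetE2.
- by rewrite mset0E.
Qed.

Lemma gdeg_msetD q p (g : 'I_q -> 'I_p) (A B : multicolor q) :
  gdeg_mset g (msetD A B) = msetD (gdeg_mset g A) (gdeg_mset g B).
Proof.
apply/msetP => b; rewrite msetE2 !gdeg_msetE.
by rewrite (perm_big _ (perm_msetD A B)) big_cat.
Qed.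

Lemma gdeg_msetn q p (g : 'I_q -> 'I_p) n (a : 'rV[nat]_q) :
  gdeg_mset g (msetn n a) = msetn n (g_sharp g a).
Proof.
apply/msetP => b; rewrite gdeg_msetE enum_msetn big_nseq msetnE eq_sym.
by case: eqP => _; rewrite iter_addn ?mul1n ?mul0n addn0.
Qed.

Lemma gdeg_mset0 q p (g : 'I_q -> 'I_p) :
  gdeg_mset g (mset0 : multicolor q) = mset0.
Proof. by apply/msetP => b; rewrite gdeg_msetE big_mset0 mset0E. Qed.

Lemma gdeg_msetB q p (g : 'I_q -> 'I_p) (A B : multicolor q) :
  msubset B A ->
  gdeg_mset g (msetB A B) = msetB (gdeg_mset g A) (gdeg_mset g B).
Proof. by move=> BA; rewrite -{2}(msetBDK BA) gdeg_msetD msetDKBC. Qed.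

Lemma g_sharpD (V : nmodType) q p (g : 'I_q -> 'I_p) (u v : 'rV[V]_q) :
  g_sharp g (u + v) = g_sharp g u + g_sharp g v.
Proof.
apply/rowP => k; rewrite !mxE -big_split; apply: eq_bigr => j _.
by rewrite mxE.
Qed.

Lemma g_sharp_unitv q p (g : 'I_q -> 'I_p) j :
  g_sharp g (unitv j) = unitv (g j).
Proof.
apply/rowP => k; rewrite !mxE (eq_bigr (fun i : 'I_q => (i == j : nat)));
  last first.
  by move=> i _; rewrite mxE.
rewrite [RHS]/= eq_sym; case: eqP => [<-|gj].
  by rewrite (bigD1 j)//= eqxx big1// => i /andP[_ /negPf ->].
by rewrite big1// => i /eqP gi; case: eqP => // ij; case: gj; rewrite -gi ij.
Qed.

Lemma subv_unitK q (a : 'rV[nat]_q) j :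
  (0 < a ord0 j)%N -> subv a (unitv j) + unitv j = a.
Proof.
move=> aj; apply/rowP => i; rewrite !mxE; apply: subnK.
by case: eqP => // ->.
Qed.

Lemma addv_unitK q (a : 'rV[nat]_q) j : subv (a + unitv j) (unitv j) = a.
Proof. by apply/rowP => i; rewrite !mxE; apply: addnK. Qed.

Lemma addv_natI q (a b c : 'rV[nat]_q) : a + c = b + c -> a = b.
Proof.
move=> /rowP h; apply/rowP => i; have := h i; rewrite !mxE.
exact: addIn.
Qed.

Lemma g_sharp_subv q p (g : 'I_q -> 'I_p) (a : 'rV[nat]_q) j :
  (0 < a ord0 j)%N ->
  g_sharp g (subv a (unitv j)) = subv (g_sharp g a) (unitv (g j)).
Proof.
move=> aj; rewrite -[in RHS](subv_unitK aj) g_sharpD g_sharp_unitv.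
by rewrite addv_unitK.
Qed.

Lemma g_sharp_ge q p (g : 'I_q -> 'I_p) (a : 'rV[nat]_q) j :
  (a ord0 j <= g_sharp g a ord0 (g j))%N.
Proof. by rewrite mxE (bigD1 j)//=; apply: leq_addr. Qed.

Lemma vnormD (V : nmodType) q (u v : 'rV[V]_q) :
  vnorm (u + v) = vnorm u + vnorm v.
Proof. by rewrite /vnorm -big_split; apply: eq_bigr => j _; rewrite mxE. Qed.

Lemma vnorm_unitv q (j : 'I_q) : vnorm (unitv j) = 1%N.
Proof.
rewrite /vnorm (bigD1 j)//= mxE eqxx big1 ?addr0// => i /negPf ij.
by rewrite mxE ij.
Qed.

Lemma vnorm_ge q (a : 'rV[nat]_q) j : (a ord0 j <= vnorm a)%N.
Proof. by rewrite /vnorm (bigD1 j)//=; apply: leq_addr. Qed.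

Lemma unitv_neq0 q (j : 'I_q) : unitv j != 0.
Proof. by rewrite -vnorm_eq0 vnorm_unitv. Qed.

Lemma g_sharp0 (V : nmodType) q p (g : 'I_q -> 'I_p) :
  g_sharp g (0 : 'rV[V]_q) = 0.
Proof. by apply/rowP => k; rewrite !mxE big1// => i _; rewrite mxE. Qed.

Lemma g_sharp_eq0 q p (g : 'I_q -> 'I_p) (a : 'rV[nat]_q) :
  (g_sharp g a == 0) = (a == 0).
Proof. by rewrite -!vnorm_eq0 vnorm_g_sharp. Qed.

(** * Discarding a ball *)

(** A part reduced to a single ball disappears when that ball is discarded, instead
of leaving a remainder. Merging does not change which case of [drop_ball] applies,
because the remainder [a - e_j] vanishes if and only if its image does. *)
Lemma unitv_g_sharp q p (g : 'I_q -> 'I_p) (a : 'rV[nat]_q) j :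
  (0 < a ord0 j)%N -> (a == unitv j) = (g_sharp g a == unitv (g j)).
Proof.
move=> aj; rewrite -{1 2}(subv_unitK aj) g_sharpD g_sharp_unitv.
have E r (b : 'rV[nat]_r) i : (b + unitv i == unitv i) = (b == 0).
  apply/eqP/eqP => [|->]; last by rewrite add0r.
  by rewrite -{2}[unitv i]add0r; apply: addv_natI.
by rewrite !E g_sharp_eq0.
Qed.

Lemma gdeg_drop_ball q p (g : 'I_q -> 'I_p) (A : multicolor q) a j :
  a \in finsupp A -> (0 < a ord0 j)%N ->
  gdeg_mset g (drop_ball A a j) = drop_ball (gdeg_mset g A) (g_sharp g a) (g j).
Proof.
move=> aA aj; rewrite /drop_ball -(unitv_g_sharp g aj).
have sA : msubset (msetn 1 a) A by rewrite msub1set -msuppE.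
case: ifP => _; first by rewrite gdeg_msetB// gdeg_msetn.
by rewrite gdeg_msetD gdeg_msetB// !gdeg_msetn g_sharp_subv.
Qed.

(** Up to parts equal to 0, discarding a ball moves one unit of mass from [a] to
[a - e_j], so [a] is recovered as the only part whose multiplicity decreased, and
then [j] from the part whose multiplicity increased, if any. *)
Lemma drop_ball_inj q (A : multicolor q) (a b : 'rV[nat]_q) j k :
  a \in finsupp A -> b \in finsupp A ->
  (0 < a ord0 j)%N -> (0 < b ord0 k)%N ->
  drop_ball A a j = drop_ball A b k -> a = b /\ j = k.
Proof.
move=> aA bA aj bk E.
pose rem (c : 'rV[nat]_q) i := subv c (unitv i).
(* Counting the remainder even when it is 0 removes the case distinction in
   [drop_ball]; this is why [d] is nonzero below. *)
have dropE (c : 'rV[nat]_q) i (d : 'rV[nat]_q) :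
  c \in finsupp A -> (0 < c ord0 i)%N -> d != 0 ->
    (drop_ball A c i d + (d == c) = A d + (d == rem c i))%N.
  move=> cA ci d0; rewrite /drop_ball -/(rem c i).
  have Ac : (0 < A c)%N by rewrite mset_gt0 -msuppE.
  case: ifPn => [/eqP cE|_].
    have -> : (d == rem c i) = false.
      rewrite /rem cE; apply/negbTE; apply: contra d0 => /eqP ->.
      by apply/eqP/rowP => l; rewrite !mxE subnn.
    rewrite msetE2 msetnE addn0; case: (d =P c) => [->|_];
      last by rewrite subn0 addn0.
    by rewrite subnK.
  rewrite !msetE2 !msetnE; case: (d =P c) => [->|_].
    by rewrite addnAC subnK//; case: (c == _).
  by rewrite subn0 addn0; case: (d == _).
have neq_rem (c : 'rV[nat]_q) i : (0 < c ord0 i)%N -> (c == rem c i) = false.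
  move=> ci; apply/negbTE/eqP => /rowP/(_ i); rewrite !mxE eqxx.
  by case: (c ord0 i) ci => // n _; rewrite subn1 /= => /esym/eqP;
    rewrite ltn_eqF.
have nz (c : 'rV[nat]_q) i : (0 < c ord0 i)%N -> c != 0.
  by move=> ci; apply/eqP => c0; rewrite c0 mxE in ci.
have eab : a = b.
  apply/eqP; case: eqP => // /eqP ab.
  have := dropE a j a aA aj (nz _ _ aj).
  have := dropE b k a bA bk (nz _ _ aj).
  rewrite E eqxx (neq_rem a j)// (negbTE ab) /= !addn0 => -> /eqP.
  by rewrite -addnA -[X in _ == X]addn0 eqn_add2l addn1.
split=> //; rewrite -{b}eab in bA bk E *.
have [//|jk] := eqVneq j k.
have remE : rem a j = rem a k.
  have [r0|r0] := eqVneq (rem a j) 0.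
    have [s0|s0] := eqVneq (rem a k) 0; first by rewrite r0 s0.
    have := dropE a j (rem a k) aA aj s0.
    rewrite E (dropE a k (rem a k))// eqxx r0 (negbTE s0).
    by move=> /eqP; rewrite eqn_add2l.
  have := dropE a k (rem a j) aA bk r0.
  rewrite -E (dropE a j (rem a j))// eqxx => /eqP; rewrite eqn_add2l.
  by case: (rem a j =P rem a k).
move: remE => /rowP/(_ j); rewrite !mxE eqxx (negbTE jk) subn0.
by case: (a ord0 j) aj => // n _; rewrite subn1 /= => /eqP; rewrite ltn_eqF.
Qed.

Lemma weightB q (A B : multicolor q) :
  msubset B A -> weight (msetB A B) = (weight A - weight B)%N.
Proof. by move=> /msetBDK {2}<-; rewrite weightD addnK. Qed.

Lemma perm_gdeg q p (g : 'I_q -> 'I_p) (A : multicolor q) :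
  perm_eq (enum_mset (gdeg_mset g A)) (map (@g_sharp nat q p g) (enum_mset A)).
Proof.
apply/allP => b _ /=; rewrite count_mem_mset gdeg_msetE count_map.
rewrite -sum1_count [X in _ == X]big_mkcond /=; apply/eqP/eq_bigr => a _.
by case: (_ == _).
Qed.

Lemma weight_gdeg q p (g : 'I_q -> 'I_p) (A : multicolor q) :
  weight (gdeg_mset g A) = weight A.
Proof.
rewrite !weightE (perm_big _ (perm_gdeg g A)) big_map.
by apply: eq_bigr => a _; rewrite vnorm_g_sharp.
Qed.

Lemma is_chromatic_gdeg q p (g : 'I_q -> 'I_p) n (A : multicolor q) :
  is_chromatic n (gdeg_mset g A) = is_chromatic n A.
Proof.
rewrite /is_chromatic weight_gdeg; congr andb.
rewrite !mset_eq0 (perm_mem (perm_gdeg g A)); congr negb.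
apply/mapP/idP => [[a aA /esym/eqP]|A0]; first by rewrite g_sharp_eq0 => /eqP <-.
by exists 0; rewrite ?g_sharp0.
Qed.

Lemma finite_vnorm q N : finite_set [set a : 'rV[nat]_q | (vnorm a <= N)%N].
Proof.
pose F (f : {ffun 'I_q -> 'I_N.+1}) : 'rV[nat]_q := \row_j (f j : nat).
apply: (sub_finite_set (B:=range F)); last exact: finite_image.
move=> a /= aN; exists [ffun j => inord (a ord0 j)] => //.
apply/rowP => j; rewrite mxE ffunE inordK// ltnS.
exact: leq_trans (vnorm_ge a j) aN.
Qed.

Lemma vnorm_le_weight q (A : multicolor q) a :
  a \in finsupp A -> (A a * vnorm a <= weight A)%N.
Proof.
move=> aA; rewrite /weight (big_fsetD1 a)//=; exact: leq_addr.
Qed.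

(** Every part of a multicolour of weight [n] has norm and multiplicity at most [n],
so that finitely many bounded data determine the multicolour. *)
Lemma finite_chromatic q n : finite_set [set A : multicolor q | is_chromatic n A].
Proof.
pose S := fset_set [set a : 'rV[nat]_q | (vnorm a <= n)%N].
have inS a : a \in S = (vnorm a <= n)%N.
  rewrite in_fset_set; last exact: finite_vnorm.
  by apply/idP/idP; rewrite inE.
pose F (f : {ffun S -> 'I_n.+1}) : multicolor q :=
  [fsfun a : S => (f a : nat)].
apply: (sub_finite_set (B:=range F)); last exact: finite_image.
move=> A /= /andP[A0 /eqP wA]; exists [ffun a => inord (A (val a))] => //.
have bd a : a \in finsupp A -> (A a <= n)%N /\ (vnorm a <= n)%N.
  move=> aA; have := vnorm_le_weight aA; rewrite wA => h.
  have v0 : (0 < vnorm a)%N.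
    by rewrite lt0n vnorm_eq0; apply: contraTneq aA => ->; rewrite memNfinsupp.
  have Aa0 : (0 < A a)%N by rewrite mset_gt0 -msuppE.
  by split; apply: leq_trans h; rewrite ?leq_pmulr ?leq_pmull.
apply/msetP => a; rewrite fsfun_ffun; case: insubP => [u uS <- /=|aS].
  rewrite ffunE inordK//; have [/bd[] //|] := boolP (val u \in finsupp A).
  by rewrite memNfinsupp => /eqP ->.
by apply/esym/eqP; rewrite -memNfinsupp; apply: contra aS => /bd[_]; rewrite inS.
Qed.

Definition lvl q n : {fset multicolor q} :=
  fset_set [set A : multicolor q | is_chromatic n A].

Lemma in_lvl q n (A : multicolor q) : (A \in lvl q n) = is_chromatic n A.
Proof.
rewrite in_fset_set; last exact: finite_chromatic.
by apply/idP/idP; rewrite inE.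
Qed.

Lemma drop_ball_chromatic q n (A : multicolor q) a j :
  is_chromatic n.+1 A -> a \in enum_mset A -> (0 < a ord0 j)%N ->
  is_chromatic n (drop_ball A a j).
Proof.
move=> /andP[/eqP A0 /eqP wA] aA aj.
have sA : msubset (msetn 1 a) A by rewrite msub1set.
have va : vnorm a = (vnorm (subv a (unitv j))).+1.
  by rewrite -{1}(subv_unitK aj) vnormD vnorm_unitv; exact: addn1.
rewrite /drop_ball; case: ifPn => [/eqP ae|ane]; apply/andP; split.
- by rewrite msetE2 A0.
- by rewrite weightB// weight_msetn wA ae vnorm_unitv subn1.
- rewrite !msetE2 A0 sub0n add0n msetnE; case: (0 =P _) => [s0|//].
  by move: ane; rewrite -[a in a == _](subv_unitK aj) -s0 add0r eqxx.
- rewrite weightD weightB// !weight_msetn !mul1n wA va subSS subnK//.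
  rewrite -ltnS -va -wA; have aA' : a \in finsupp A by rewrite msuppE.
  by apply: leq_trans (vnorm_le_weight aA'); rewrite leq_pmull// mset_gt0.
Qed.

(** At most one ball of [A] produces [B], so the choice made by [sampling] can be
replaced by a sum over all the balls, which is what behaves well under merging. *)
Lemma samplingE (R : realType) q (A B : multicolor q) :
  sampling R A B =
  (\sum_(a <- enum_mset A) \sum_j a ord0 j * (B == drop_ball A a j))%N%:R
  / (weight A)%:R.
Proof.
rewrite -sum_finsupp_mset big_seq_fsetE /=.
under eq_bigr do rewrite big_distrr /=.
rewrite pair_big /= /sampling; case: pickP => [u|nou].
  move=> /andP[u0 /eqP uE]; rewrite
    (bigD1 u)//= -uE eqxx muln1 mulnC big1 ?addn0//.
  move=> v vu; have [v0|] := posnP ((val v.1 : 'rV[nat]_q) ord0 v.2).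
    by rewrite v0 mul0n muln0.
  move=> v0; case: eqP => [vE|_]; last by rewrite !muln0.
  have [] := drop_ball_inj (valP u.1) (valP v.1) u0 v0.
    by rewrite -uE.
  move=> /val_inj e1 e2; move: vu; rewrite [v]surjective_pairing -e1 -e2.
  by rewrite -surjective_pairing eqxx.
rewrite big1 ?mul0r// => v _; have := nou v.
case: posnP => [->|_ /= ->]; by rewrite ?mul0n ?muln0.
Qed.

(** Both sides are sums over the balls of [A], and merging acts ball by ball. *)
Lemma sampling_gdeg (R : realType) q p (g : 'I_q -> 'I_p) n
    (A : multicolor q) (C : multicolor p) :
  is_chromatic n.+1 A ->
  \sum_(B <- lvl q n | gdeg_mset g B == C) sampling R A B =
  sampling R (gdeg_mset g A) C.
Proof.
move=> An; under eq_bigr do rewrite samplingE.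
rewrite -big_distrl /= samplingE weight_gdeg -natr_sum; congr (_%:R / _).
rewrite exchange_big /= (perm_big _ (perm_gdeg g A)) big_map big_seq [RHS]big_seq.
apply: eq_bigr => a aA; rewrite exchange_big /=.
transitivity (\sum_j a ord0 j *
    (C == drop_ball (gdeg_mset g A) (g_sharp g a) (g j)))%N.
  apply: eq_bigr => j _; rewrite -big_distrr /=.
  have [->|aj] := posnP (a ord0 j); first by rewrite !mul0n.
  congr (_ * _)%N; rewrite -gdeg_drop_ball ?msuppE//.
  have DA := drop_ball_chromatic An aA aj.
  rewrite big_mkcond (bigD1_seq (drop_ball A a j)) ?in_lvl ?fset_uniq//= eqxx.
  rewrite big1 ?addr0; first by rewrite eq_sym; case: eqP.
  by move=> B /negPf ->; rewrite if_same.
rewrite (partition_big g predT)//=; apply: eq_bigr => k _.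
by rewrite mxE big_distrl; apply: eq_bigr => j /eqP ->.
Qed.

(** * Partition structures as mass functions *)

Lemma finite_chromT q n : finite_set [set: chrom q n].
Proof.
rewrite -(preimage_setT (@multiset_of_chrom q n)).
apply: (@sub_finite_set _ _
  (@multiset_of_chrom q n @^-1` [set A | is_chromatic n A])).
  by move=> A _ /=; exact: (valP A).
apply: finite_preimage; last exact: finite_chromatic.
by move=> A B _ _; exact: val_inj.
Qed.

Lemma perm_lvl q n :
  perm_eq (map val (fset_set [set: chrom q n] : seq (chrom q n))) (lvl q n).
Proof.
apply: uniq_perm; rewrite ?(map_inj_uniq val_inj) ?fset_uniq//.
move=> A; rewrite in_lvl; apply/mapP/idP => [[c _ ->]|An]; first exact: (valP c).
by exists (Sub A An); rewrite ?SubK// in_fset_set ?inE//; exact: finite_chromT.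
Qed.

Lemma fsbig_chrom (V : Type) (idx : V) (op : Monoid.com_law idx) q n
    (P : pred (multicolor q)) (F : multicolor q -> V) :
  \big[op/idx]_(c \in [set c : chrom q n | P (val c)]) F (val c) =
  \big[op/idx]_(A <- lvl q n | P A) F A.
Proof.
rewrite -(perm_big _ (perm_lvl q n)) big_map [RHS]big_mkcond /= [LHS]fsbig_mkcond.
rewrite fsbig_finite; last exact: finite_chromT.
apply: eq_bigr => c _; rewrite /patch.
by case: ifPn => [|/negP]; rewrite inE /=; case: (P _).
Qed.

Lemma fsbig_chromT (V : Type) (idx : V) (op : Monoid.com_law idx) q n
    (F : multicolor q -> V) :
  \big[op/idx]_(c \in [set: chrom q n]) F (val c) =
  \big[op/idx]_(A <- lvl q n) F A.
Proof.
rewrite -(fsbig_chrom op n xpredT).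
by apply: eq_fsbigl; apply/seteqP; split.
Qed.

Section probability_of_mass.
Context (R : realType) (q n : nat) (m : multicolor q.+1 -> R).
Hypotheses (m0 : forall A, 0 <= m A) (m1 : \sum_(A <- lvl q.+1 n) m A = 1).

Let s : seq (chrom q.+1 n) := fset_set [set: chrom q.+1 n].

Definition mass_measure : set (chrom q.+1 n) -> \bar R :=
  msum (fun k => mscale (NngNum (m0 (val (nth point s k))))
                   (@dirac _ (chrom q.+1 n) (nth point s k) R)) (size s).

HB.instance Definition _ := Measure.on mass_measure.

Lemma mass_measureE E :
  mass_measure E = (\sum_(c <- s | c \in E) (m (val c))%:E)%E.
Proof.
rewrite [RHS]big_mkcond (big_nth point) big_mkord /=; apply: eq_bigr => k _.
transitivity ((m (val (nth point s k)))%:E * \d_(nth point s k) E)%E => //.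
by rewrite diracE; case: (_ \in _); rewrite ?mule1 ?mule0.
Qed.

Lemma mass_measureT : mass_measure setT = 1%E.
Proof.
rewrite mass_measureE -m1 -(perm_big _ (perm_lvl q.+1 n)) big_map -sumEFin.
by apply: eq_bigl => c; rewrite in_setT.
Qed.

HB.instance Definition _ :=
  Measure_isProbability.Build _ _ _ mass_measure mass_measureT.

Lemma exists_probability : exists P : probability (chrom q.+1 n) R,
  forall c, P [set c] = (m (val c))%:E.
Proof.
exists mass_measure => c; rewrite [LHS]mass_measureE big_mkcond.
rewrite (bigD1_seq c) ?fset_uniq//=; last first.
  by rewrite in_fset_set ?inE//; exact: finite_chromT.
rewrite in_set1 eqxx big1 ?adde0// => d dc.
by rewrite in_set1 (negbTE dc).
Qed.

End probability_of_mass.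

Section mass.
Context (R : realType).

(** The laws of all sizes fit into one function, since the size of a multicolour is
its weight. *)
Definition is_pmass q (m : multicolor q -> R) : Prop :=
  [/\ forall A, 0 <= m A, forall n, \sum_(A <- lvl q n) m A = 1 &
      forall n B, is_chromatic n B ->
        m B = \sum_(A <- lvl q n.+1) m A * sampling R A B].

Definition mass_of q (P : forall n, probability (chrom q.+1 n) R)
    (A : multicolor q.+1) : R :=
  if insub A : option (chrom q.+1 (weight A)) is Some c
  then fine (P (weight A) [set c]) else 0.

Lemma mass_ofE q (P : forall n, probability (chrom q.+1 n) R) n
  (c : chrom q.+1 n) : P n [set c] = (mass_of P (val c))%:E.
Proof.
case: c => A An; have /andP[_ /eqP wA] : is_chromatic n A by [].
by subst n; rewrite /mass_of insubT /= fineK ?fin_num_measure.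
Qed.

Lemma probability_chrom q n (P : probability (chrom q.+1 n) R) E :
  P E = (\sum_(c \in E) P [set c])%E.
Proof.
rewrite [E in LHS](_ : _ = \bigcup_(c in E) [set c]).
  apply: measure_fin_bigcup => //.
    by apply: sub_finite_set (finite_chromT q.+1 n).
  by move=> c d _ _ [x [-> ->]].
by apply/seteqP; split => [c Ec|c [d Ed ->]//]; exists c.
Qed.

Lemma mass_of_ge0 q (P : forall n, probability (chrom q.+1 n) R) A :
  0 <= mass_of P A.
Proof. by rewrite /mass_of; case: insub => // c; rewrite fine_ge0. Qed.

Lemma mass_of_sum q (P : forall n, probability (chrom q.+1 n) R) n :
  \sum_(A <- lvl q.+1 n) mass_of P A = 1.
Proof.
apply: EFin_inj; rewrite -sumEFin -(@probability_setT _ _ _ (P n)).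
rewrite probability_chrom -(fsbig_chromT _ n (fun A => (mass_of P A)%:E)).
by apply: eq_fsbigr => c _; rewrite mass_ofE.
Qed.

Lemma partition_structureE q (P : forall n, probability (chrom q.+1 n) R) :
  partition_structure P <-> is_pmass (mass_of P).
Proof.
have key n (B : chrom q.+1 n) :
    (\sum_(A \in [set: chrom q.+1 n.+1]) P n.+1 [set A] * (sampling R A B)%:E)%E =
    (\sum_(A <- lvl q.+1 n.+1) mass_of P A * sampling R A (val B))%:E.
  rewrite -sumEFin.
  rewrite -(fsbig_chromT _ _ (fun A => (mass_of P A * sampling R A (val B))%:E)).
  by apply: eq_fsbigr => A _; rewrite mass_ofE.
split=> [PS|[_ _ PS] n B]; last first.
  by rewrite mass_ofE key; congr _%:E; apply: PS; exact: (valP B).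
split; [exact: mass_of_ge0|exact: mass_of_sum|move=> n B Bn].
by apply: EFin_inj; rewrite -(key n (Sub B Bn)) -PS mass_ofE SubK.
Qed.

Lemma exists_structure q (m : multicolor q.+1 -> R) : is_pmass m ->
  exists2 P : forall n, probability (chrom q.+1 n) R, partition_structure P &
    forall n (c : chrom q.+1 n), P n [set c] = (m (val c))%:E.
Proof.
move=> [m0 m1 mS].
pose P n := sval (cid (exists_probability m0 (m1 n))).
have PE n (c : chrom q.+1 n) : P n [set c] = (m (val c))%:E.
  by rewrite /P; case: cid => //= Q QE; rewrite QE.
have mE A n : is_chromatic n A -> mass_of P A = m A.
  by move=> An; apply: EFin_inj; rewrite -(mass_ofE P (Sub A An)) PE SubK.
exists P => //; apply/partition_structureE; split.
- exact: mass_of_ge0.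
- exact: mass_of_sum.
- move=> n B Bn; rewrite (mE _ _ Bn) (mS n)// big_seq [RHS]big_seq.
  by apply: eq_bigr => A; rewrite in_lvl => /mE ->.
Qed.

Lemma eq_pmass q (m m' : multicolor q -> R) :
  (forall n A, is_chromatic n A -> m A = m' A) -> (forall A, 0 <= m' A) ->
  is_pmass m -> is_pmass m'.
Proof.
move=> e m'0 [m0 m1 mS]; split => // [n|n B Bn].
  rewrite -(m1 n) big_seq [RHS]big_seq; apply: eq_bigr => A.
  by rewrite in_lvl => /e ->.
rewrite -(e n)// (mS n)// big_seq [RHS]big_seq; apply: eq_bigr => A.
by rewrite in_lvl => /e ->.
Qed.

Definition push_mass q p (g : 'I_q -> 'I_p) (m : multicolor q -> R)
    (B : multicolor p) : R :=
  \sum_(A <- lvl q (weight B) | gdeg_mset g A == B) m A.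

Lemma is_chromatic_weight q n (A : multicolor q) :
  is_chromatic n A -> weight A = n.
Proof. by case/andP => _ /eqP. Qed.

Lemma sum_push_mass q p (g : 'I_q -> 'I_p) (m : multicolor q -> R) n
    (F : multicolor p -> R) :
  \sum_(B <- lvl p n) push_mass g m B * F B =
  \sum_(A <- lvl q n) m A * F (gdeg_mset g A).
Proof.
transitivity (\sum_(B <- lvl p n) \sum_(A <- lvl q n)
    if gdeg_mset g A == B then m A * F (gdeg_mset g A) else 0).
  rewrite big_seq [RHS]big_seq; apply: eq_bigr => B; rewrite in_lvl => Bn.
  rewrite /push_mass (is_chromatic_weight Bn) big_mkcond big_distrl /=.
  by apply: eq_bigr => A _; case: eqP => [->|]; rewrite ?mul0r.
rewrite exchange_big /= big_seq [RHS]big_seq; apply: eq_bigr => A.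
rewrite in_lvl => An; rewrite (bigD1_seq (gdeg_mset g A)) ?fset_uniq//=;
  last first.
  by rewrite in_lvl is_chromatic_gdeg.
by rewrite eqxx big1 ?addr0// => B; rewrite eq_sym => /negPf ->.
Qed.

Lemma push_mass_sampling q p (g : 'I_q -> 'I_p) (m : multicolor q -> R) n C :
  is_chromatic n C ->
  \sum_(B <- lvl q n | gdeg_mset g B == C)
     \sum_(A <- lvl q n.+1) m A * sampling R A B =
  \sum_(A <- lvl p n.+1) push_mass g m A * sampling R A C.
Proof.
move=> Cn; rewrite sum_push_mass exchange_big /= big_seq [RHS]big_seq.
by apply: eq_bigr => A; rewrite in_lvl -big_distrr /= => /sampling_gdeg ->.
Qed.

Lemma push_mass_pmass q p (g : 'I_q -> 'I_p) m :
  is_pmass m -> is_pmass (push_mass g m).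
Proof.
move=> [m0 m1 mS]; split => [B|n|n C Cn].
- by apply: sumr_ge0.
- rewrite -(m1 n); have := sum_push_mass g m n (fun=> 1).
  by under eq_bigr do rewrite mulr1; under [RHS]eq_bigr do rewrite mulr1.
- rewrite -push_mass_sampling// /push_mass (is_chromatic_weight Cn).
  rewrite big_seq_cond [RHS]big_seq_cond; apply: eq_bigr => B /andP[].
  by rewrite in_lvl => Bn _; exact: mS.
Qed.

Lemma mass_of_gdeg_push q p (g : 'I_q.+1 -> 'I_p.+1)
    (P : forall n, probability (chrom q.+1 n) R) n B :
  is_chromatic n B -> mass_of (gdeg_push g P) B = push_mass g (mass_of P) B.
Proof.
move=> Bn; apply: EFin_inj; rewrite -(mass_ofE _ (Sub B Bn)).
rewrite [LHS]/= /gdeg_push /distribution /pushforward probability_chrom.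
rewrite /push_mass -sumEFin
  -(fsbig_chrom _ _ (fun A => gdeg_mset g A == B) (fun A => (mass_of P A)%:E)).
rewrite (is_chromatic_weight Bn).
rewrite (_ : _ @^-1` _ = [set c : chrom q.+1 n | gdeg_mset g (val c) == B]).
  by apply: eq_fsbigr => c _; rewrite mass_ofE.
apply/seteqP; split => c /= => [/(congr1 (@multiset_of_chrom _ _)) /= ->|/eqP cB];
  first by rewrite eqxx.
exact: val_inj.
Qed.

Lemma partition_structure_gdeg_push q p (g : 'I_q.+1 -> 'I_p.+1)
    (P : forall n, probability (chrom q.+1 n) R) :
  partition_structure P -> partition_structure (gdeg_push g P).
Proof.
move=> /partition_structureE/(push_mass_pmass g) PS; apply/partition_structureE.
apply: eq_pmass PS => [n A An|]; last exact: mass_of_ge0.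
by rewrite (mass_of_gdeg_push _ _ An).
Qed.

End mass.

(** * Extremality by lifting decompositions *)

(** By Tychonoff's theorem; using a filter on the functions themselves, rather than
a subsequence, all the coordinates converge along the same limit. *)
Lemma bounded_seq_cluster (R : realType) (T : choiceType) (u : nat -> T -> R)
  (b : T -> R) :
  (forall k A, 0 <= u k A <= b A) ->
  exists2 L : T -> R, (forall A, 0 <= L A <= b A) &
  exists G : set_system (T -> R), [/\ ProperFilter G,
    forall Q : set (T -> R), (\forall k \near \oo, Q (u k)) -> G Q &
    forall A, f A @[f --> G] --> L A].
Proof.
move=> ub; have /= cK : compact [set f : prod_topology (fun _ : T => R) |
    forall A, [set` `[0, b A]] (f A)].
  by apply: (@tychonoff T (fun=> R) (fun A => [set` `[0, b A]])) => A;
    exact: segment_compact.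
have [G [UG uG]] := ultraFilterLemma
  (fmap_proper_filter u (eventually_filter : ProperFilter \oo)).
move: cK; rewrite compact_ultra => /(_ G UG)[].
  apply: uG; exists 0%N => // k _ A; rewrite /= in_itv /=; exact: ub.
move=> L [LK GL]; exists L; first by move=> A; have := LK A; rewrite /= in_itv.
exists G; split => //; first exact: ultra_proper.
move=> A; have := @proj_continuous T (fun=> R) A L.
exact: cvg_trans (cvg_app _ GL).
Qed.

Lemma cvg_wsum (R : realType) (T : choiceType) (G : set_system (T -> R))
    (L : T -> R) (s : seq T) (P : pred T) (w : T -> R) : Filter G ->
  (forall A, f A @[f --> G] --> L A) ->
  \sum_(A <- s | P A) f A * w A @[f --> G] --> \sum_(A <- s | P A) L A * w A.
Proof.
move=> FG GL; elim: s => [|A s IH].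
  rewrite big_nil; under eq_fun do rewrite big_nil; exact: cvg_cst.
rewrite big_cons; under eq_fun do rewrite big_cons.
case: (P A) => //; apply: cvgD IH; apply: cvgMl; exact: GL.
Qed.

Section lift.
Context (R : realType) (q p : nat) (g : 'I_q -> 'I_p).

(** The size is not an argument, so that the law of the backward chain after [j] steps
is the [j]-th iterate of this map. *)
Definition sample_step (f : multicolor q -> R) (B : multicolor q) : R :=
  \sum_(A <- lvl q (weight B).+1) f A * sampling R A B.

Lemma sampling_ge0 (A B : multicolor q) : 0 <= sampling R A B.
Proof. by rewrite samplingE divr_ge0. Qed.

Lemma iter_sample_le (f m : multicolor q -> R) (t : R) : is_pmass m ->
  (forall n A, is_chromatic n A -> f A <= m A * t) ->
  forall j n A, is_chromatic n A -> iter j sample_step f A <= m A * t.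
Proof.
move=> [m0 _ mS] fm; elim=> [|j IH] n B Bn; first exact: fm Bn.
rewrite iterS /sample_step (is_chromatic_weight Bn) (mS n)// big_distrl /=.
rewrite big_seq [leRHS]big_seq; apply: ler_sum => A; rewrite in_lvl => An.
by rewrite mulrAC ler_wpM2r ?sampling_ge0//; exact: IH An.
Qed.

Lemma iter_sample_ge0 (f : multicolor q -> R) :
  (forall A, 0 <= f A) -> forall j A, 0 <= iter j sample_step f A.
Proof.
move=> f0; elim=> [|j IH] A //; rewrite iterS; apply: sumr_ge0 => B _.
by rewrite mulr_ge0 ?sampling_ge0.
Qed.

(** Sampling down and merging commute, and [r] is invariant under sampling down. *)
Lemma push_iter_sample (f : multicolor q -> R) (r : multicolor p -> R) :
  is_pmass r -> (forall n C, is_chromatic n C -> push_mass g f C = r C) ->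
  forall j n C, is_chromatic n C -> push_mass g (iter j sample_step f) C = r C.
Proof.
move=> [_ _ rS] fr; elim=> [|j IH] n C Cn; first exact: fr Cn.
rewrite (rS n)// /push_mass (is_chromatic_weight Cn).
transitivity (\sum_(B <- lvl q n | gdeg_mset g B == C)
     \sum_(A <- lvl q n.+1) iter j sample_step f A * sampling R A B).
  rewrite big_seq_cond [RHS]big_seq_cond; apply: eq_bigr => B /andP[].
  by rewrite in_lvl => Bn _; rewrite iterS /sample_step (is_chromatic_weight Bn).
rewrite push_mass_sampling// big_seq [RHS]big_seq; apply: eq_bigr => A.
by rewrite in_lvl => /IH ->.
Qed.

(** The mass [h] is [m] reweighted at each weight by the density of [r] with respect
to the image of [m]; it lies above [r] and below [m / t], but it is not consistent
between weights. Sampling it down from weight [k] keeps both properties and makes it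
consistent below [k], so any limit point as [k] grows is the required lift. *)
Lemma lift_pmass (m : multicolor q -> R) (r : multicolor p -> R) (t : R) :
  is_pmass m -> is_pmass r -> 0 < t ->
  (forall n C, is_chromatic n C -> t * r C <= push_mass g m C) ->
  exists m1, [/\ is_pmass m1,
    forall n A, is_chromatic n A -> t * m1 A <= m A &
    forall n C, is_chromatic n C -> push_mass g m1 C = r C].
Proof.
move=> mm rr t0 rm; have [m0 m1 mS] := mm; have [r0 r1 rS] := rr.
pose h A := m A * (r (gdeg_mset g A) / push_mass g m (gdeg_mset g A)).
have gm0 C : 0 <= push_mass g m C by apply: sumr_ge0.
have h0 A : 0 <= h A by rewrite mulr_ge0// divr_ge0.
have hm n A : is_chromatic n A -> h A <= m A * t^-1.
  move=> An; rewrite ler_wpM2l//.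
  have [->|gmA] := eqVneq (push_mass g m (gdeg_mset g A)) 0.
    by rewrite invr0 mulr0 invr_ge0 ltW.
  rewrite ler_pdivrMr ?lt_def ?gmA ?gm0//.
  rewrite -(ler_pM2l t0) mulrA mulfV ?gt_eqF// mul1r.
  by apply: (rm n); rewrite is_chromatic_gdeg.
have hr n C : is_chromatic n C -> push_mass g h C = r C.
  move=> Cn; transitivity (push_mass g m C * (r C / push_mass g m C)).
    by rewrite /push_mass big_distrl /=; apply: eq_bigr => A /eqP <-.
  (* Where the image of [m] vanishes, so does [r]. *)
  have [gmC|gmC] := eqVneq (push_mass g m C) 0;
    last by rewrite mulrCA mulfV ?mulr1.
  rewrite gmC mul0r; apply/esym/eqP; rewrite eq_le r0 andbT.
  by rewrite -(pmulr_rle0 _ t0) -gmC (rm n).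
(* Off the chromatic multicolours any value in [0, m A / t] would do. *)
pose u k (A : multicolor q) := if A 0 ==
  0%N then iter (k - weight A) sample_step h A else 0.
have uE n k A : is_chromatic n A -> u k A = iter (k - n) sample_step h A.
  by rewrite /u => /andP[-> /eqP <-].
have ub k A : 0 <= u k A <= m A * t^-1.
  rewrite /u; case: eqP => A0; last by rewrite lexx mulr_ge0// invr_ge0 ltW.
  rewrite iter_sample_ge0//=; apply: (iter_sample_le mm hm _ (n := weight A)).
  by rewrite /is_chromatic A0 !eqxx.
have [L Lb [G [PG Gu GL]]] := bounded_seq_cluster ub.
have Glim (s : seq (multicolor q)) (P : pred (multicolor q))
  (w : multicolor q -> R) (v : R) :
    (\forall k \near \oo, \sum_(A <- s | P A) u k A * w A = v) ->
    \sum_(A <- s | P A) L A * w A = v.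
  move=> /(Gu [set f | \sum_(A <- s | P A) f A * w A = v]) Gv.
  pose F (f : multicolor q -> R) := \sum_(A <- s | P A) f A * w A.
  have c1 : F @ G --> \sum_(A <- s | P A) L A * w A by exact: cvg_wsum.
  have c2 : F @ G --> v by exact: cvg_near_cst.
  exact: (cvg_unique (@Rhausdorff R) c1 c2).
have gL n C : is_chromatic n C -> push_mass g L C = r C.
  move=> Cn; have := Glim (lvl q n) (fun A => gdeg_mset g A == C) (fun=> 1) (r C).
  rewrite /push_mass (is_chromatic_weight Cn); under eq_bigr do rewrite mulr1.
  apply; exists n => // k /= nk; rewrite -(push_iter_sample rr hr (k - n) Cn).
  rewrite /push_mass (is_chromatic_weight Cn).
  rewrite big_seq_cond [RHS]big_seq_cond; apply: eq_bigr => A /andP[].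
  by rewrite in_lvl mulr1 => /uE ->.
have L0 A : 0 <= L A by have /andP[] := Lb A.
exists L; split => //; last first.
  by move=> n A An; have /andP[_] := Lb A; rewrite ler_pdivlMr// mulrC.
split=> // [n|n B Bn].
  transitivity (\sum_(C <- lvl p n) push_mass g L C * 1).
    by rewrite sum_push_mass; apply: eq_bigr => A _; rewrite mulr1.
  rewrite -[RHS](r1 n) big_seq [RHS]big_seq; apply: eq_bigr => C.
  by rewrite in_lvl mulr1 => /gL ->.
apply/eqP; rewrite -subr_eq0; apply/eqP.
(* The consistency equation as one linear equation on finitely many values, in
   which [B] and the multicolours of weight [n + 1] are distinct. *)
pose w A := (A == B)%:R - (is_chromatic n.+1 A)%:R * sampling R A B.
have BA A : is_chromatic n.+1 A -> (A == B) = false.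
  move=> An; apply/eqP => AB; move: An; rewrite AB => /is_chromatic_weight.
  by rewrite (is_chromatic_weight Bn) => /eqP; rewrite ltn_eqF.
have Bn1 : is_chromatic n.+1 B = false.
  by apply/negP => /BA; rewrite eqxx.
have wE f : \sum_(A <- B :: lvl q n.+1) f A * w A =
    f B - \sum_(A <- lvl q n.+1) f A * sampling R A B.
  rewrite big_cons /w eqxx Bn1 mul0r subr0 mulr1 -sumrN; congr (_ + _).
  rewrite big_seq [RHS]big_seq; apply: eq_bigr => A; rewrite in_lvl => An.
  by rewrite An BA// mul1r sub0r mulrN.
rewrite -wE; apply: Glim; exists n.+1 => // k /= nk; rewrite wE.
apply/eqP; rewrite subr_eq0 (uE n)// -(subnSK nk) iterS /sample_step
  (is_chromatic_weight Bn).
rewrite big_seq [X in _ == X]big_seq; apply/eqP/eq_bigr => A.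
by rewrite in_lvl => /uE ->.
Qed.

End lift.

Section extremality.
Context (R : realType).

(** The complement of [t * m1] in [P], normalized, is a partition structure too, so
that [m1] is a term of a convex decomposition of [P]. *)
Lemma extremal_pmass q (P : forall n, probability (chrom q.+1 n) R) m1 t :
  extremal P -> is_pmass m1 -> 0 < t < 1 ->
  (forall n A, is_chromatic n A -> t * m1 A <= mass_of P A) ->
  forall n A, is_chromatic n A -> m1 A = mass_of P A.
Proof.
move=> [PS Pext] m1P t01 m1le; have /andP[t0 t1] := t01.
have [m10 m11 m1S] := m1P.
have /partition_structureE[_ P1 PS'] := PS.
have s0 : 0 < 1 - t by rewrite subr_gt0.
pose m2 (A : multicolor q.+1) : R :=
  if A 0 == 0%N then (mass_of P A - t * m1 A) / (1 - t) else 0.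
have m2E n A : is_chromatic n A -> m2 A = (mass_of P A - t * m1 A) / (1 - t).
  by rewrite /m2 => /andP[-> _].
have m2P : is_pmass m2.
  split=> [A|n|n B Bn].
  - rewrite /m2; case: eqP => // A0; rewrite divr_ge0 ?(ltW s0)// subr_ge0.
    by apply: (m1le (weight A)); rewrite /is_chromatic A0 !eqxx.
  - transitivity ((\sum_(A <- lvl q.+1 n) (mass_of P A - t * m1 A)) / (1 - t)).
      rewrite big_distrl big_seq [RHS]big_seq; apply: eq_bigr => A.
      by rewrite in_lvl => /m2E ->.
    by rewrite big_split /= sumrN -big_distrr /= P1 m11 mulr1 mulfV ?gt_eqF.
  - rewrite (m2E n)// (PS' n)// (m1S n)// big_distrr /= -sumrB big_distrl /=.
    rewrite big_seq [RHS]big_seq; apply: eq_bigr => A.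
    by rewrite in_lvl => /m2E ->; rewrite mulrAC mulrA -mulrBl mulrAC.
have [Q1 Q1S Q1E] := exists_structure m1P.
have [Q2 Q2S Q2E] := exists_structure m2P.
have Pmix n E : (P n E = t%:E * Q1 n E + (1 - t)%:E * Q2 n E)%E.
  rewrite !probability_chrom !ge0_mule_fsumr// -fsbig_split/=; last first.
    by apply: sub_finite_set (finite_chromT q.+1 n).
  apply: eq_fsbigr => c _; rewrite mass_ofE Q1E Q2E -!EFinM -EFinD (m2E n);
    last exact: (valP c).
  by rewrite [(1 - t) * _]mulrC divfK ?gt_eqF// addrC subrK.
move=> n A An; apply: EFin_inj.
have [+ _] := Pext Q1 Q2 t Q1S Q2S t01 Pmix n [set Sub A An].
by rewrite Q1E mass_ofE SubK.
Qed.

Lemma extremal_gdeg_push q p (g : 'I_q.+1 -> 'I_p.+1)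
    (P : forall n, probability (chrom q.+1 n) R) :
  extremal P -> extremal (gdeg_push g P).
Proof.
move=> eP; have [PS _] := eP; split; first exact: partition_structure_gdeg_push.
have key (Q1 Q2 : forall n, probability (chrom p.+1 n) R) (t : R) :
    partition_structure Q1 -> 0 < t < 1 ->
    (forall n E, gdeg_push g P n E = t%:E * Q1 n E + (1 - t)%:E * Q2 n E)%E ->
    forall n E, Q1 n E = gdeg_push g P n E.
  move=> /partition_structureE Q1S t01 mix n E; have /andP[t0 t1] := t01.
  have /partition_structureE mP := PS.
  have [||m1 [m1P m1le m1g]] := lift_pmass (g := g) (t := t) mP Q1S => //.
    move=> k C Ck; rewrite -(mass_of_gdeg_push _ _ Ck) -lee_fin EFinM.
    rewrite -!(mass_ofE _ (Sub C Ck)) mix leeDl// mule_ge0//.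
    by rewrite lee_fin subr_ge0 ltW.
  have m1E := extremal_pmass eP m1P t01 m1le.
  rewrite !probability_chrom; apply: eq_fsbigr => c _; rewrite !mass_ofE.
  have cn := valP c : is_chromatic n (val c).
  rewrite (mass_of_gdeg_push _ _ cn) -(m1g n)// /push_mass
    (is_chromatic_weight cn).
  congr _%:E; rewrite big_seq_cond [RHS]big_seq_cond; apply: eq_bigr => A /andP[].
  by rewrite in_lvl => /m1E ->.
move=> Q1 Q2 t Q1S Q2S t01 mix n E; split; first exact: (key Q1 Q2 t).
have /andP[t0 t1] := t01.
apply: (key Q2 Q1 (1 - t)) => //; first by rewrite subr_gt0 t1 ltrBlDl ltrDr t0.
by move=> k F; rewrite mix addeC subKr.
Qed.

End extremality.

(** * The multinomial theorem in divided powers *)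

(** Divided powers absorb the factorials of [phi] and [psi], and turn the multinomial
theorem into a sum without coefficients. *)
Definition divpow (R : realType) q (v : 'rV[R]_q) (a : 'rV[nat]_q) : R :=
  vpow v a / (vfact a)%:R.

Definition vecs q n : {fset 'rV[nat]_q} := fset_set
  [set a : 'rV[nat]_q | (vnorm a <= n)%N].

Lemma in_vecs q n (a : 'rV[nat]_q) : (a \in vecs q n) = (vnorm a <= n)%N.
Proof.
rewrite in_fset_set; last exact: finite_vnorm.
by apply/idP/idP; rewrite inE.
Qed.

Definition g_sharp_fiber q p (g : 'I_q -> 'I_p) (b : 'rV[nat]_p) :
  seq 'rV[nat]_q :=
  [seq a <- vecs q (vnorm b) | g_sharp g a == b].

Lemma g_sharp_fiber_uniq q p (g : 'I_q -> 'I_p) b : uniq (g_sharp_fiber g b).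
Proof. by rewrite filter_uniq ?fset_uniq. Qed.

Lemma in_g_sharp_fiber q p (g : 'I_q -> 'I_p) b a :
  (a \in g_sharp_fiber g b) = (g_sharp g a == b).
Proof.
rewrite mem_filter in_vecs; case: eqP => //= <-.
by rewrite vnorm_g_sharp leqnn.
Qed.

Lemma vfact_gt0 q (a : 'rV[nat]_q) : (0 < vfact a)%N.
Proof. by rewrite /vfact; apply: prodn_gt0 => j; exact: fact_gt0. Qed.

Lemma vpow_ge0 (R : realType) q (v : 'rV[R]_q) a :
  (forall j, 0 <= v ord0 j) -> 0 <= vpow v a.
Proof. by move=> v0; apply: prodr_ge0 => j _; rewrite exprn_ge0. Qed.

Lemma divpow_ge0 (R : realType) q (v : 'rV[R]_q) a :
  (forall j, 0 <= v ord0 j) -> 0 <= divpow v a.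
Proof. by move=> v0; rewrite divr_ge0// vpow_ge0. Qed.

Lemma vpow0 (R : realType) q (v : 'rV[R]_q) : vpow v 0 = 1.
Proof. by rewrite /vpow big1// => j _; rewrite mxE expr0. Qed.

Lemma vfact0 q : vfact (0 : 'rV[nat]_q) = 1%N.
Proof. by rewrite /vfact big1// => j _; rewrite mxE. Qed.

(** The derivative of a divided power is the divided power of lower degree. *)
Lemma divpow_unitv (R : realType) q (v : 'rV[R]_q) (a : 'rV[nat]_q) j :
  (0 < a ord0 j)%N ->
  (a ord0 j)%:R * divpow v a = v ord0 j * divpow v (subv a (unitv j)).
Proof.
move=> aj; have aE : a ord0 j = (subv a (unitv j) ord0 j).+1.
  by rewrite !mxE eqxx subn1 prednK.
have aE' k : k != j -> subv a (unitv j) ord0 k = a ord0 k.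
  by move=> kj; rewrite !mxE (negbTE kj) subn0.
rewrite /divpow /vpow /vfact (bigD1 j)//= [in RHS](bigD1 j)//=.
rewrite [X in _ / X%:R](bigD1 j)//= [X in _ = _ * (_ / X%:R)](bigD1 j)//=.
under [in RHS]eq_bigr do rewrite aE'//.
under [X in _ = _ * (_ / (_ * X)%:R)]eq_bigr do rewrite aE'//.
rewrite {1 2 3}aE factS !natrM exprS.
set c := (_.+1)%:R; set e := (_`!)%:R; set d := (_%:R).
have c0 : c != 0 by rewrite pnatr_eq0.
have e0 : e != 0 by rewrite pnatr_eq0 -lt0n fact_gt0.
have d0 : d != 0 by rewrite pnatr_eq0 -lt0n prodn_gt0// => k; rewrite fact_gt0.
clearbody c e d; field; by rewrite ?c0 ?e0 ?d0.
Qed.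

(** The multinomial theorem in divided powers. It follows by induction on the degree
from the identity of Euler: for a homogeneous polynomial, the degree times the
polynomial is the sum of the variables times the partial derivatives. *)
Lemma divpow_g_sharp (R : realType) q p (g : 'I_q -> 'I_p) (v : 'rV[R]_q) b :
  divpow (g_sharp g v) b = \sum_(c <- g_sharp_fiber g b) divpow v c.
Proof.
have [N] := ubnP (vnorm b); elim: N b => // N IH b; rewrite ltnS => bN.
have [b0|b0] := eqVneq b 0.
  rewrite b0 (perm_big [:: (0 : 'rV[nat]_q)]) ?big_seq1 ?/divpow ?vpow0 ?vfact0//.
  apply: uniq_perm; rewrite ?g_sharp_fiber_uniq// => c.
  by rewrite in_g_sharp_fiber g_sharp_eq0 inE.
have vb0 : (vnorm b)%:R != 0 :> R by rewrite pnatr_eq0 vnorm_eq0.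
(* The derivative in direction [j] vanishes on the exponents whose [j]-th entry is
   0, where the truncated subtraction in [subv] would not give 0. *)
have euler r (u : 'rV[R]_r) (a : 'rV[nat]_r) : (vnorm a)%:R * divpow u a =
    \sum_j (if (0 < a ord0 j)%N then u ord0 j *
      divpow u (subv a (unitv j)) else 0).
  rewrite /vnorm natr_sum big_distrl /=; apply: eq_bigr => j _.
  by case: posnP => [->|aj]; rewrite ?mul0r// divpow_unitv.
apply: (mulfI vb0); rewrite euler big_distrr /=.
transitivity (\sum_(c <- g_sharp_fiber g b) \sum_j
    (if (0 < c ord0 j)%N then v ord0 j * divpow v (subv c (unitv j)) else 0)).
  rewrite exchange_big /= [RHS](partition_big g predT)//=; apply: eq_bigr => k _.
  case: ifPn => bk; last first.
    rewrite big1// => j /eqP jk; rewrite big_seq big1// => c.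
    rewrite in_g_sharp_fiber => /eqP cb; case: ifPn => // cj.
    by case/negP: bk; rewrite -cb -jk; apply: leq_trans (g_sharp_ge _ _ _).
  rewrite mxE big_distrl /=; apply: eq_bigr => j /eqP jk.
  rewrite IH; last first.
    apply: leq_trans bN; rewrite -{2}(subv_unitK bk) vnormD vnorm_unitv.
    by rewrite -[_ + _]/(_ + _)%N addn1.
  rewrite -big_mkcond -big_distrr /=; congr (_ * _); rewrite -[RHS]big_filter.
  transitivity (\sum_(c <- map (fun c => subv c (unitv j))
      [seq c <- g_sharp_fiber g b |
        (0 < (c : 'rV[nat]_q) ord0 j)%N]) divpow v c); last by rewrite big_map.
  apply: perm_big; apply: uniq_perm; rewrite ?g_sharp_fiber_uniq//.
    rewrite map_inj_in_uniq ?(filter_uniq _ (g_sharp_fiber_uniq g b))// => c d.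
    rewrite !mem_filter => /andP[cj _] /andP[dj _] e.
    by rewrite -(subv_unitK cj) e subv_unitK.
  move=> c; rewrite in_g_sharp_fiber; apply/eqP/mapP => [cb|[d]].
    exists (c + unitv j); last by rewrite addv_unitK.
    rewrite mem_filter in_g_sharp_fiber g_sharpD cb g_sharp_unitv jk
      subv_unitK// eqxx andbT.
    by rewrite !mxE eqxx -[_ + _]/(_ + _)%N addn1.
  by rewrite mem_filter in_g_sharp_fiber => /andP[dj /eqP <-] ->;
    rewrite g_sharp_subv// jk.
rewrite big_seq [RHS]big_seq; apply: eq_bigr => c;
  rewrite in_g_sharp_fiber => /eqP <-.
by rewrite -euler vnorm_g_sharp.
Qed.

Fixpoint lifts q p (g : 'I_q -> 'I_p) (L : seq 'rV[nat]_p) :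
  seq (seq 'rV[nat]_q) :=
  if L is b :: L' then [seq a :: M | a <- g_sharp_fiber g b, M <- lifts g L']
    else [:: [::]].

Lemma size_lifts q p (g : 'I_q -> 'I_p) L M : M \in lifts g L -> size M = size L.
Proof.
elim: L M => [|b L IH] M /=; first by rewrite inE => /eqP ->.
by move=> /allpairsP[[a M'] /= [_ /IH <- ->]].
Qed.

(** The sequence [f] is indexed by [nat] in order to shift it in the induction. *)
Lemma prod_divpow_lifts (R : realType) q p (g : 'I_q -> 'I_p)
    (f : nat -> 'rV[R]_q) (L : seq 'rV[nat]_p) :
  \prod_(h < size L) divpow (g_sharp g (f h)) (nth 0 L h) =
  \sum_(M <- lifts g L) \prod_(h < size L) divpow (f h) (nth 0 M h).
Proof.
elim: L f => [|b L IH] f /=; first by rewrite big_seq1 !big_ord0.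
rewrite big_ord_recl /= divpow_g_sharp
  (IH (f \o S)) big_allpairs_dep big_distrl /=.
apply: eq_bigr => a _; rewrite big_distrr /=; apply: eq_bigr => M _.
by rewrite big_ord_recl.
Qed.

(** * Multisets above a given multiset *)

Definition mfact (K : choiceType) (A : {mset K}%mset) : nat :=
  (\prod_(a <- finsupp A) (A a)`!)%N.

Lemma mfact_gt0 (K : choiceType) (A : {mset K}%mset) : (0 < mfact A)%N.
Proof. by rewrite /mfact; apply: prodn_gt0 => a; exact: fact_gt0. Qed.

Lemma mfact_widen (K : choiceType) (A : {mset K}%mset) (S : {fset K}) :
  (finsupp A `<=` S)%fset -> mfact A = (\prod_(a <- S) (A a)`!)%N.
Proof.
move=> AS; rewrite /mfact; apply: big_fset_incl => // a _.
by rewrite memNfinsupp => /eqP ->.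
Qed.

Lemma mfact0 (K : choiceType) : mfact (mset0 : {mset K}%mset) = 1%N.
Proof. by rewrite /mfact finsupp0 big_seq_fset0. Qed.

Lemma mfact_cons (K : choiceType) a (A : {mset K}%mset) :
  mfact (msetD (msetn 1 a) A) = ((A a).+1 * mfact A)%N.
Proof.
pose S := (a |` finsupp A)%fset.
have aS : a \in S by rewrite !inE eqxx.
have AS : (finsupp A `<=` S)%fset by exact: fsubsetU1.
have DS : (finsupp (msetD (msetn 1 a) A) `<=` S)%fset.
  by apply/fsubsetP => b; rewrite msuppE in_mset1D !inE -msuppE.
rewrite (mfact_widen AS) (mfact_widen DS)
  (big_fsetD1 a)//= [in RHS](big_fsetD1 a)//=.
rewrite mset1DE eqxx add1n.
rewrite factS -mulnA; congr (_ * (_ * _))%N.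
rewrite big_seq [RHS]big_seq; apply: eq_bigr => b;
  rewrite !inE => /andP[/negPf ba _].
by rewrite mset1DE ba.
Qed.

Lemma weight_msubset q (A B : multicolor q) :
  msubset A B -> (weight A <= weight B)%N.
Proof. by move=> /msetBDK <-; rewrite weightD leq_addl. Qed.

Section fibers.
Context (q p : nat) (g : 'I_q -> 'I_p).

Lemma gdeg_msubset (A B : multicolor q) :
  msubset A B -> msubset (gdeg_mset g A) (gdeg_mset g B).
Proof.
move=> /msetBDKC <-; rewrite gdeg_msetD; apply/msubsetP => b.
by rewrite msetE2 leq_addr.
Qed.

(** Adding [D] is a bijection from the multisets above [B - gdeg D] to the
multisets above [B] that contain [D]. It serves both to peel one part off and to
remove the dust. *)
Lemma big_fiber_shift (V : Type) (idx : V) (op : Monoid.com_law idx)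
    (D : multicolor q) (B : multicolor p) (F : multicolor q -> V) :
  D 0 = 0%N -> B 0 = 0%N -> msubset (gdeg_mset g D) B ->
  \big[op/idx]_(A <- lvl q (weight B) | (gdeg_mset g A == B) && msubset D A) F A =
  \big[op/idx]_(A <- lvl q (weight (msetB B (gdeg_mset g D)))
     | gdeg_mset g A == msetB B (gdeg_mset g D)) F (msetD D A).
Proof.
move=> D0 B0 DB; rewrite -[LHS]big_filter -[RHS]big_filter
  -[RHS](big_map (msetD D) predT F).
apply: perm_big; apply: uniq_perm.
- by rewrite filter_uniq ?fset_uniq.
- rewrite map_inj_uniq ?filter_uniq ?fset_uniq//; exact: can_inj (msetDKB D).
move=> A; rewrite mem_filter in_lvl; apply/idP/mapP.
  move=> /andP[/andP[/eqP AB DA] _]; exists (msetB A D); last by rewrite msetBDKC.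
  rewrite mem_filter in_lvl gdeg_msetB// AB eqxx -(is_chromatic_gdeg g).
  by rewrite gdeg_msetB// AB /is_chromatic msetE2 B0 eqxx.
move=> [A']; rewrite mem_filter => /andP[/eqP A'B _] ->.
rewrite -(is_chromatic_gdeg g) gdeg_msetD A'B msetBDKC// /is_chromatic B0 !eqxx
  /= andbT.
by apply/msubsetP => a; rewrite msetE2 leq_addr.
Qed.

Lemma big_fiber_none (V : Type) (idx : V) (op : Monoid.com_law idx)
    (D : multicolor q) (B : multicolor p) (F : multicolor q -> V) :
  ~~ msubset (gdeg_mset g D) B ->
  \big[op/idx]_(A <- lvl q (weight B) | (gdeg_mset g A == B) && msubset D A) F A
    = idx.
Proof.
move=> DB; rewrite big1// => A /andP[/eqP AB /gdeg_msubset]; rewrite AB.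
by rewrite (negPf DB).
Qed.

Lemma sum_g_sharp_fiber (A : multicolor q) b :
  (\sum_(a <- g_sharp_fiber g b) A a)%N = gdeg_mset g A b.
Proof.
rewrite gdeg_msetE (eq_bigr (fun a => \sum_(c <- enum_mset A) (c == a))%N);
  last first.
  move=> a _; rewrite -count_mem_mset -sum1_count big_mkcond /=.
  by apply: eq_bigr => c _; case: (c == a).
rewrite exchange_big /=; apply: eq_bigr => c _.
have [cb|cb] := eqVneq (g_sharp g c) b.
  rewrite (bigD1_seq c) ?g_sharp_fiber_uniq ?in_g_sharp_fiber ?cb//= eqxx
    big1// => a.
  by rewrite eq_sym => /negPf ->.
rewrite big_seq big1// => a; rewrite in_g_sharp_fiber => /eqP ab.
by case: eqP => // ca; rewrite -ab -ca eqxx in cb.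
Qed.

Lemma lvl0 (A : multicolor q) : A \in lvl q 0 -> A = mset0.
Proof.
rewrite in_lvl => /andP[/eqP A0 /eqP wA]; apply/msetP => a; rewrite mset0E.
have [->//|a0] := eqVneq a 0; apply/eqP; rewrite -leqn0 leqNgt; apply/negP => Aa.
have aA : a \in finsupp A by rewrite msuppE -mset_gt0.
have := vnorm_le_weight aA; rewrite wA leqn0 muln_eq0 vnorm_eq0 (negPf a0) orbF.
by rewrite eqn0Ngt Aa.
Qed.

(** Each multiset [A] above [b] is the multiset of exactly [b! / A!] sequences above
the sequence [b], where the factorial of a multiset is the product of those of its
multiplicities. By induction on [b]: the first entry of the lift can be any element [a]
of [A] above the first entry of [b], which contributes [A a / A!], and the
multiplicities [A a] of these elements add up to the multiplicity of that entry in [b]. *)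
Lemma sum_lifts (R : realType) (F : multicolor q -> \bar R) (b : seq 'rV[nat]_p) :
  (forall A, 0 <= F A)%E -> 0 \notin b ->
  (\sum_(M <- lifts g b) F (seq_mset M) =
   (mfact (seq_mset b))%:R%:E *
   \sum_(A <- lvl q (weight (seq_mset b)) | gdeg_mset g A == seq_mset b)
      ((mfact A)%:R^-1)%:E * F A)%E.
Proof.
elim: b F => [|b0 b IH] F F0.
  have s0 r : seq_mset ([::] : seq 'rV[nat]_r) = mset0.
    by apply/msetP => a; rewrite mset_seqE mset0E.
  rewrite big_seq1 !s0 mfact0 weight0 mul1e => _; apply/esym.
  rewrite big_mkcond (bigD1_seq mset0) ?fset_uniq//=; last first.
    by rewrite in_lvl /is_chromatic weight0 mset0E eqxx.
  rewrite gdeg_mset0 eqxx mfact0 invr1 mul1e big_seq_cond big1 ?adde0//.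
  by move=> A /andP[/lvl0 ->]; rewrite eqxx.
rewrite inE negb_or => /andP[b00 bn0].
set B' := seq_mset b; set B := seq_mset (b0 :: b).
have BE : B = msetD (msetn 1 b0) B' by rewrite /B mset_cons.
have B0 : B 0 = 0%N.
  by apply/eqP; rewrite mset_seqE -leqn0 leqNgt -has_count has_pred1 inE negb_or
    b00.
rewrite big_allpairs_dep /=.
pose H (a : 'rV[nat]_q) (A : multicolor q) :=
  (((A a)%:R / (mfact A)%:R)%:E * F A)%E.
have H0 a A : (0 <= H a A)%E by rewrite mule_ge0// lee_fin divr_ge0.
transitivity (\sum_(a <- g_sharp_fiber g b0) (mfact B')%:R%:E *
    \sum_(A <- lvl q (weight B) | gdeg_mset g A == B) H a A)%E.
  rewrite big_seq [RHS]big_seq; apply: eq_bigr => a;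
    rewrite in_g_sharp_fiber => /eqP ab.
  under eq_bigr do rewrite mset_cons.
  rewrite (IH (fun A => F (msetD (msetn 1 a) A)))//; congr (_ * _)%E.
  have gD : gdeg_mset g (msetn 1 a) = msetn 1 b0 by rewrite gdeg_msetn ab.
  have B'E : B' = msetB B (gdeg_mset g (msetn 1 a)) by rewrite gD BE msetDKB.
  transitivity (\sum_(A <- lvl q (weight B) | (gdeg_mset g A == B) &&
      msubset (msetn 1%N a) A) H a A)%E; last first.
    rewrite big_mkcondr; apply: eq_bigr => A _; rewrite msub1set -mset_gt0.
    by case: posnP => // Aa; rewrite /H Aa mul0r mul0e.
  have D0 : msetn 1%N a 0 = 0%N.
    rewrite msetnE; case: eqP => // a0.
    by move: b00; rewrite -ab -a0 g_sharp0 eqxx.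
  have DB : msubset (gdeg_mset g (msetn 1%N a)) B.
    by rewrite gD BE; apply/msubsetP => c; rewrite msetE2 leq_addr.
  rewrite [RHS](big_fiber_shift _ _ D0 B0 DB) -B'E.
  apply: eq_bigr => A _; rewrite /H mfact_cons mset1DE eqxx add1n.
  by rewrite natrM invfM mulrA mulfV ?mul1r// pnatr_eq0.
rewrite -ge0_sume_distrr; last by move=> a _; apply: sume_ge0.
rewrite exchange_big /= BE mfact_cons mulnC natrM EFinM -muleA; congr (_ * _)%E.
rewrite -BE ge0_sume_distrr; last by move=> A _; rewrite mule_ge0.
apply: eq_bigr => A /eqP AB; rewrite -ge0_sume_distrl; last first.
  by move=> a _; rewrite lee_fin divr_ge0.
rewrite sumEFin -big_distrl /= -natr_sum sum_g_sharp_fiber AB muleA -EFinM.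
by rewrite BE mset1DE eqxx add1n.
Qed.

End fibers.

(** * The sum over injective maps *)

Lemma esumZl (R : realType) (T : choiceType) (I : set T) (c : R)
  (f : T -> \bar R) :
  0 <= c -> (forall i, 0 <= f i)%E ->
  \esum_(i in I) (c%:E * f i)%E = (c%:E * \esum_(i in I) f i)%E.
Proof.
move=> c0 f0; rewrite /esum -ereal_supZl//; last first.
  by apply/set0P; exists 0%E; exists set0; [exact: fsets_set0|rewrite fsbig_set0].
rewrite image_comp; congr ereal_sup; apply: eq_imagel => A _ /=.
by rewrite ge0_mule_fsumr.
Qed.

Section Phi.
Context (R : realType).

(** The sum over injective maps in [phi], written with divided powers and for any
sequence of exponents; it depends only on the multiset of the exponents. *)
Definition Phi r q (x : nat -> 'rV[R]_q) (L : seq 'rV[nat]_q) : \bar R :=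
  \esum_(iota in inj_maps r)
    (\prod_(h < r) divpow (x (iota h)) (nth 0 L h))%:E.

Lemma Phi_ge0 r q (x : nat -> 'rV[R]_q) L :
  (forall i j, 0 <= x i ord0 j) -> (0 <= Phi r x L)%E.
Proof.
move=> x0; apply: esum_ge0 => i _; rewrite lee_fin; apply: prodr_ge0 => h _.
exact: divpow_ge0.
Qed.

(** Permuting the exponents amounts to composing the injective maps with a
permutation. *)
Lemma Phi_perm q (x : nat -> 'rV[R]_q) L L' :
  perm_eq L L' -> Phi (size L) x L = Phi (size L') x L'.
Proof.
move=> LL'; have sL := perm_size LL'; rewrite sL.
have [s Es] : exists s : 'S_(size L'),
    forall h : 'I_(size L'), nth 0 L h = nth 0 L' (s h).
  have /tuple_permP[s Ls] : perm_eq L (in_tuple L') by [].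
  exists s => h; rewrite Ls (nth_map h) ?size_enum_ord//
    (tnth_nth 0) nth_ord_enum.
  by [].
pose e (i : {ffun 'I_(size L') -> nat}) := [ffun h => i (s h)].
have eb : set_bij (inj_maps (size L')) (inj_maps (size L')) e.
  split.
  - move=> i [ii i0]; split=> [h k|h]; last by rewrite ffunE.
    by rewrite !ffunE => /ii /perm_inj.
  - move=> i j _ _ /ffunP ij; apply/ffunP => h.
    by have := ij (s^-1 h)%g; rewrite !ffunE permKV.
  - move=> i [ii i0]; exists [ffun h => i (s^-1 h)%g]; last first.
      by apply/ffunP => h; rewrite !ffunE permK.
    split=> [h k|h]; last by rewrite ffunE.
    by rewrite !ffunE => /ii /perm_inj.
rewrite /Phi (reindex_esum _ _ _ _ eb); apply: eq_esum => i _; congr _%:E.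
rewrite [RHS](reindex_inj (@perm_inj _ s))/=; apply: eq_bigr => h _.
by rewrite ffunE Es.
Qed.

(** Rearranging the boxes composes the injective maps with a bijection of the
positive integers, hence the shifts by one around [sigma]. *)
Lemma Phi_rearrange r q (x y : nat -> 'rV[R]_q) (sigma : nat -> nat) L :
  bijective sigma -> (forall i, y i.+1 = x (sigma i).+1) ->
  Phi r y L = Phi r x L.
Proof.
move=> [tau sK tK] yx.
pose e (i : {ffun 'I_r -> nat}) := [ffun h => (sigma (i h).-1).+1].
have sI := can_inj sK.
have eb : set_bij (inj_maps r) (inj_maps r) e.
  split.
  - move=> i [ii i0]; split=> [h k|h]; last by rewrite ffunE.
    rewrite !ffunE => -[/sI hk]; apply: ii.
    by rewrite -(prednK (i0 h)) hk prednK.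
  - move=> i j; rewrite !inE => -[_ i0] [_ j0] /ffunP ij; apply/ffunP => h.
    have := ij h; rewrite !ffunE => -[/sI hk].
    by rewrite -(prednK (i0 h)) hk prednK.
  - move=> i [ii i0]; exists [ffun h => (tau (i h).-1).+1]; last first.
      by apply/ffunP => h; rewrite !ffunE /= tK prednK.
    split=> [h k|h]; last by rewrite ffunE.
    rewrite !ffunE => -[/(can_inj tK) hk]; apply: ii.
    by rewrite -(prednK (i0 h)) hk prednK.
rewrite /Phi [RHS](reindex_esum _ _ _ _ eb); apply: eq_esum => i [_ i0];
  congr _%:E.
by apply: eq_bigr => h _; rewrite ffunE -yx prednK.
Qed.

Lemma Phi_lifts q p (g : 'I_q -> 'I_p) (x : nat -> 'rV[R]_q) L :
  (forall i j, 0 <= x i ord0 j) ->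
  Phi (size L) (fun i => g_sharp g (x i)) L =
  (\sum_(M <- lifts g L) Phi (size M) x M)%E.
Proof.
move=> x0; transitivity (\sum_(M <- lifts g L) Phi (size L) x M)%E; last first.
  by rewrite big_seq [RHS]big_seq; apply: eq_bigr => M /size_lifts ->.
rewrite -esum_sum; last first.
  by move=> i M _ _; rewrite lee_fin; apply: prodr_ge0 => h _; exact: divpow_ge0.
apply: eq_esum => i _; rewrite sumEFin; congr _%:E.
pose f k := if insub k is Some h then x (i h) else 0.
have fE (h : 'I_(size L)) : f h = x (i h) by rewrite /f valK.
under eq_bigr do rewrite -fE.
rewrite prod_divpow_lifts; apply: eq_bigr => M _.
by apply: eq_bigr => h _; rewrite fE.
Qed.

Definition mset_Phi q (x : nat -> 'rV[R]_q) (A : multicolor q) : \bar R :=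
  Phi (size (enum_mset A)) x (enum_mset A).

(** This is [phi] divided by the factorial of the number of balls, see [phiE]. *)
Definition divphi q (x : nat -> 'rV[R]_q) (A : multicolor q) : \bar R :=
  (((mfact A)%:R^-1)%:E * mset_Phi x A)%E.

Lemma divphi_ge0 q (x : nat -> 'rV[R]_q) (A : multicolor q) :
  (forall i j, 0 <= x i ord0 j) -> (0 <= divphi x A)%E.
Proof. by move=> x0; rewrite mule_ge0 ?Phi_ge0// lee_fin invr_ge0. Qed.

(** The multinomial theorem in each factor, followed by the count of [sum_lifts]. *)
Lemma divphi_g_sharp q p (g : 'I_q -> 'I_p) (x : nat -> 'rV[R]_q)
  (B : multicolor p) :
  (forall i j, 0 <= x i ord0 j) -> B 0 = 0%N ->
  divphi (fun i => g_sharp g (x i)) B =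
  (\sum_(A <- lvl q (weight B) | gdeg_mset g A == B) divphi x A)%E.
Proof.
move=> x0 B0; rewrite /divphi {1}/mset_Phi Phi_lifts//.
transitivity (((mfact B)%:R^-1)%:E *
  \sum_(M <- lifts g (enum_mset B)) mset_Phi x (seq_mset M))%E.
  congr (_ * _)%E; apply: eq_bigr => M _; apply: Phi_perm.
  by rewrite perm_sym perm_eq_seq_mset.
rewrite sum_lifts ?seq_mset_id; last 2 first.
- by move=> A; exact: Phi_ge0.
- by apply/mset_eq0P.
by rewrite muleA -EFinM mulVf ?mul1e// pnatr_eq0 -lt0n mfact_gt0.
Qed.

Lemma phiE q (x : nat -> 'rV[R]_q) (A : multicolor q) :
  (forall i j, 0 <= x i ord0 j) ->
  phi x A = ((weight A)`!%:R%:E * divphi x A)%E.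
Proof.
move=> x0; have pA : perm_eq (parts A) (enum_mset A) by rewrite perm_sort.
have sA : nparts A = size (parts A) by rewrite (perm_size pA) size_mset.
rewrite /divphi /mset_Phi -(Phi_perm x pA) -sA muleA -EFinM /phi.
have vA0 : \prod_(a <- finsupp A) (vfact a ^ A a)%:R != 0 :> R.
  rewrite prodf_seq_neq0; apply/allP => a _ /=.
  by rewrite pnatr_eq0 -lt0n expn_gt0 vfact_gt0.
transitivity (((weight A)`!%:R / (mfact A)%:R)%:E *
   ((\prod_(a <- finsupp A) (vfact a ^ A a)%:R)^-1%:E *
    \esum_(iota in inj_maps (nparts A))
       (\prod_(h < nparts A) vpow (x (iota h)) (nth 0 (parts A) h))%:E))%E.
  rewrite muleA -EFinM; congr (_%:E * _)%E; rewrite -mulrA; congr (_ * _).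
  rewrite /mfact natr_prod -invfM -big_split/= -prodfV; apply: eq_bigr => a _.
  by rewrite natrM mulrC.
congr (_ * _)%E; rewrite /Phi.
rewrite -esumZl; last 2 first.
- by rewrite invr_ge0 prodr_ge0.
- by move=> i; rewrite lee_fin prodr_ge0// => h _; exact: vpow_ge0.
apply: eq_esum => i _; rewrite -EFinM; congr _%:E.
rewrite prodf_div mulrC; congr (_ / _).
transitivity (\prod_(a <- parts A) (vfact a)%:R : R).
  rewrite (perm_big _ pA) big_mset; apply: eq_bigr => a _.
  by rewrite natrX Monoid.iteropE iter_mulr_1.
by rewrite (big_nth 0) big_mkord sA.
Qed.

End Phi.

(** * Merging commutes with psi *)

Lemma dustE q (m : 'rV[nat]_q) a :
  dust m a = (\sum_j (if a == unitv j then m ord0 j else 0))%N.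
Proof.
rewrite /dust (big_morph (fun B : multicolor q => B a) (id1 := 0%N)
  (op1 := addn)).
- by apply: eq_bigr => j _; rewrite msetnE.
- by move=> B C; rewrite msetE2.
- by rewrite mset0E.
Qed.

Lemma dust0 q (m : 'rV[nat]_q) : dust m 0 = 0%N.
Proof.
by rewrite dustE big1// => j _; rewrite eq_sym (negPf (unitv_neq0 j)).
Qed.

Lemma weight_dust q (m : 'rV[nat]_q) : weight (dust m) = vnorm m.
Proof.
rewrite /dust (big_morph _ (@weightD _) (@weight0 _)).
by apply: eq_bigr => j _; rewrite weight_msetn vnorm_unitv muln1.
Qed.

Lemma gdeg_dust q p (g : 'I_q -> 'I_p) (m : 'rV[nat]_q) :
  gdeg_mset g (dust m) = dust (g_sharp g m).
Proof.
rewrite {1}/dust (big_morph _ (@gdeg_msetD _ _ g) (@gdeg_mset0 _ _ g)).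
apply/msetP => b; rewrite dustE.
rewrite (big_morph (fun B : multicolor p => B b) (id1 := 0%N) (op1 := addn)).
- rewrite (partition_big g predT)//=; apply: eq_bigr => k _.
  transitivity (\sum_(j | g j == k) if b == unitv k then m ord0 j else 0)%N.
    apply: eq_bigr => j /eqP jk.
    by rewrite gdeg_msetn g_sharp_unitv msetnE jk.
  by case: ifP => _; rewrite ?mxE// big1.
- by move=> B C; rewrite msetE2.
- by rewrite mset0E.
Qed.

Section psi.
Context (R : realType).

Lemma psiE q (x : nat -> 'rV[R]_q) (A : multicolor q) :
  (forall i j, 0 <= x i ord0 j) ->
  psi x A = ((weight A)`!%:R%:E *
    \sum_(m <- vecs q (weight A) | msubset (dust m) A)
      (divpow (x 0%N) m)%:E * divphi x (msetB A (dust m)))%E.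
Proof.
move=> x0; rewrite /psi; congr (_ * _)%E.
have sV m : msubset (dust m) A -> (vnorm m <= weight A)%N.
  by move=> /weight_msubset; rewrite weight_dust.
rewrite fsbig_finite; last first.
  by apply: (sub_finite_set _ (finite_vnorm q (weight A))) => m /sV.
rewrite -[RHS]big_filter; rewrite
  (perm_big [seq m <- vecs q (weight A) | msubset (dust m) A]).
  rewrite big_seq [RHS]big_seq; apply: eq_bigr => m;
    rewrite mem_filter => /andP[mA _].
  rewrite phiE// weightB// weight_dust muleA -EFinM; congr (_%:E * _)%E.
  by rewrite /divpow invfM mulrA mulfVK.
apply: uniq_perm; rewrite ?filter_uniq ?fset_uniq// => m.
rewrite mem_filter in_vecs in_fset_set; last first.
  by apply: (sub_finite_set _ (finite_vnorm q (weight A))) => k /sV.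
apply/idP/andP; rewrite inE /=; last by case.
by move=> mA; rewrite mA sV.
Qed.

Lemma psi_ge0 q (x : nat -> 'rV[R]_q) (A : multicolor q) :
  (forall i j, 0 <= x i ord0 j) -> (0 <= psi x A)%E.
Proof.
move=> x0; rewrite psiE// mule_ge0// sume_ge0// => m _.
by rewrite mule_ge0 ?divphi_ge0// lee_fin divpow_ge0.
Qed.

(** Both sides are sums over the numbers [m] of dust balls of each of the [q]
colours: on the left the multinomial theorem splits the power of the merged dust, and
on the right each multicolour is split into its dust [m] and the rest. *)
Lemma psi_lift q p (g : 'I_q -> 'I_p) (x : nat -> 'rV[R]_q)
    (y : nat -> 'rV[R]_p) (B : multicolor p) :
  (forall i j, 0 <= x i ord0 j) -> is_lift g x y -> B 0 = 0%N ->
  psi y B = (\sum_(A <- lvl q (weight B) | gdeg_mset g A == B) psi x A)%E.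
Proof.
move=> x0 [y0 [sigma sbij ysigma]] B0.
have gx0 i k : 0 <= g_sharp g (x i) ord0 k.
  by rewrite mxE; apply: sumr_ge0 => j _; exact: x0.
have yE C : divphi y C = divphi (fun i => g_sharp g (x i)) C.
  by congr (_ * _)%E; exact: Phi_rearrange sbij ysigma.
have yy0 i k : 0 <= y i ord0 k.
  by case: i => [|i]; rewrite ?y0// ysigma.
set n := weight B.
pose T (m : 'rV[nat]_q) (A : multicolor q) : \bar R :=
  ((divpow (x 0%N) m)%:E * divphi x (msetB A (dust m)))%E.
have T0 m A : (0 <= T m A)%E by rewrite mule_ge0 ?divphi_ge0// lee_fin divpow_ge0.
transitivity (n`!%:R%:E * \sum_(A <- lvl q n | gdeg_mset g A == B)
    \sum_(m <- vecs q n | msubset (dust m) A) T m A)%E; last first.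
  rewrite ge0_sume_distrr; last by move=> A _; apply: sume_ge0.
  rewrite big_seq_cond [RHS]big_seq_cond; apply: eq_bigr => A /andP[].
  by rewrite in_lvl => /is_chromatic_weight An _; rewrite psiE// An.
rewrite psiE//; congr (_ * _)%E.
transitivity (\sum_(m <- vecs q n)
    if msubset (dust (g_sharp g m)) B
    then (divpow (x 0%N) m)%:E *
      divphi y (msetB B (dust (g_sharp g m))) else 0)%E.
  pose f (m : 'rV[nat]_q) (b : 'rV[nat]_p) : \bar R :=
    if msubset (dust b) B
    then ((divpow (x 0%N) m)%:E * divphi y (msetB B (dust b)))%E else 0%E.
  transitivity (\sum_(b <- vecs p n) \sum_(m <- vecs q n)
      if g_sharp g m == b then f m b else 0)%E.
    rewrite big_mkcond big_seq [RHS]big_seq; apply: eq_bigr => b;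
      rewrite in_vecs => bn.
    rewrite -big_mkcond -[RHS]big_filter (perm_big (g_sharp_fiber g b));
      last first.
      apply: uniq_perm; rewrite ?filter_uniq ?fset_uniq ?g_sharp_fiber_uniq// =>
        m.
      rewrite mem_filter in_g_sharp_fiber in_vecs; case: eqP => //= mb.
      by rewrite -(vnorm_g_sharp g) mb bn.
    rewrite /f; case: ifP => _; last by rewrite big1.
    rewrite y0 divpow_g_sharp -sumEFin ge0_sume_distrl// => m _.
    by rewrite lee_fin divpow_ge0.
  rewrite exchange_big /= big_seq [RHS]big_seq; apply: eq_bigr => m.
  rewrite in_vecs => mn; rewrite (bigD1_seq (g_sharp g m)) ?fset_uniq//=;
    last first.
    by rewrite in_vecs vnorm_g_sharp.
  by rewrite eqxx big1 ?adde0// => b; rewrite eq_sym => /negPf ->.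
under [RHS]eq_bigr do rewrite big_mkcond.
rewrite exchange_big /=; apply: eq_bigr => m _; rewrite -big_mkcondr /=.
rewrite -gdeg_dust; case: ifPn => mB; last by rewrite big_fiber_none.
rewrite big_fiber_shift// ?dust0// yE divphi_g_sharp//; last first.
  by rewrite msetE2 B0.
rewrite ge0_sume_distrr; last by move=> A _; exact: divphi_ge0.
by apply: eq_bigr => A _; rewrite /T msetDKB.
Qed.

Lemma psi_law_lift q p (g : 'I_q.+1 -> 'I_p.+1) (x : simplex R q) n :
  pushforward (psi_law x (n := n)) (@gdeg q.+1 p.+1 g n)
  = psi_law (lift_deg g x) (n := n).
Proof.
have [x0 _ _] : kingman_simplex R q.+1 (val x) by case: x => x /=; rewrite inE.
apply/funext => E; rewrite /pushforward /psi_law.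
have PE (B : chrom p.+1 n) : psi (val (lift_deg g x)) (val B) =
    (\sum_(A \in [set A : chrom q.+1 n | gdeg_mset g (val A) == val B])
       psi (val x) (val A))%E.
  rewrite (psi_lift x0 (svalP (cid (lift_exists g x)))); last first.
    by case: B => B /= /andP[/eqP].
  rewrite (is_chromatic_weight (valP B)).
  by rewrite (fsbig_chrom _ _ (fun A => gdeg_mset g A == val B) (psi (val x))).
have big_all r (S : set (chrom r n)) (F : chrom r n -> \bar R) :
    (\sum_(c \in S) F c = \sum_(c <- fset_set [set: chrom r n]) if c \in S
      then F c else 0)%E.
  by rewrite fsbig_mkcond fsbig_finite//; exact: finite_chromT.
have in_all r (c : chrom r n) : c \in fset_set [set: chrom r n].
  by rewrite in_fset_set ?inE//; exact: finite_chromT.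
rewrite [RHS]big_all; under [RHS]eq_bigr do rewrite PE big_all.
transitivity (\sum_(B <- fset_set [set: chrom p.+1 n])
    \sum_(A <- fset_set [set: chrom q.+1 n])
      if gdeg g A == B then (if B \in E then psi (val x) (val A) else 0) else
        0)%E.
  rewrite exchange_big /= big_all; apply: eq_bigr => A _.
  rewrite (bigD1_seq (gdeg g A)) ?fset_uniq ?in_all//= eqxx big1 ?adde0.
    by congr (if _ then _ else _); apply/idP/idP; rewrite !inE.
  by move=> B; rewrite eq_sym => /negPf ->.
apply: eq_bigr => B _; case: ifP => BE; last by rewrite big1// => A _;
  rewrite if_same.
apply: eq_bigr => A _; congr (if _ then _ else _).
apply/eqP/idP; rewrite inE /=; first by move=> <-.
by move=> /eqP AB; exact: val_inj.
Qed.

End psi.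

(** * Measurability of psi *)

Section coordinates.
Context (R : realType) (q : nat).

Lemma simplex_coord_continuous i j :
  continuous (fun x : simplex R q => val x i ord0 j : R).
Proof.
move=> x; pose v := (fun x : simplex R q => val x : {ptws nat -> 'rV[R]_q.+1}).
have cv : {for x, continuous v} by exact: (@initial_continuous _ _ _ x).
have cp : {for v x, continuous (fun y : {ptws nat -> 'rV[R]_q.+1} => y i)}.
  exact: (@proj_continuous nat (fun=> 'rV[R]_q.+1) i (v x)).
have cc : {for (v x i), continuous (fun M : 'rV[R]_q.+1 => M ord0 j)}.
  exact: coord_continuous.
exact: (continuous_comp (continuous_comp cv cp) cc).
Qed.

Lemma measurable_simplex_coord i j :
  measurable_fun [set: simplex R q] (fun x : simplex R q => val x i ord0 j : R).
Proof.
apply: (measurability _ (RGenOpens.measurableE R)) => _ [_ [a [b ->] <-]].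
rewrite setTI; apply: sub_sigma_algebra.
have /continuousP := @simplex_coord_continuous i j.
by apply; exact: interval_open.
Qed.

Lemma simplex_ge0 (x : simplex R q) i j : 0 <= val x i ord0 j.
Proof. by case: x => x /=; rewrite inE => -[]. Qed.

End coordinates.

(** Enumerating the countable index set turns the sum into a series. *)
Lemma measurable_esum d (T : measurableType d) (R : realType) (I : countType)
    (P : set I) (f : T -> I -> \bar R) :
  (forall x i, 0 <= f x i)%E -> (forall i, measurable_fun setT (f ^~ i)) ->
  measurable_fun setT (fun x => \esum_(i in P) f x i).
Proof.
move=> f0 mf.
pose a x n := if (choice.unpickle n : option I) is Some i then f x i else 0%E.
have -> : (fun x => \esum_(i in P) f x i) =
    (fun x => \sum_(n <oo | n \in choice.pickle @` P) a x n)%E.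
  apply/funext => x; rewrite nneseries_esum; last first.
    by move=> n _; rewrite /a; case: choice.unpickle.
  rewrite set_mem_set esum_image; last first.
    by move=> i j _ _; exact: (pcan_inj choice.pickleK).
  by apply: eq_esum => i _; rewrite /a choice.pickleK.
apply: ge0_emeasurable_sum => [n x _ _|n _]; first by rewrite /a;
  case: choice.unpickle.
by rewrite /a; case: choice.unpickle => // ?; exact: measurable_cst.
Qed.

Section psi_measurable.
Context (R : realType) (q : nat).

Lemma measurable_divpow i (a : 'rV[nat]_q.+1) :
  measurable_fun [set: simplex R q] (fun x : simplex R q => divpow (val x i) a).
Proof.
apply: measurable_funM; last exact: measurable_cst.
apply: measurable_prod => j _.
by apply: measurable_funX; exact: measurable_simplex_coord.
Qed.

Lemma measurable_Phi r (L : seq 'rV[nat]_q.+1) :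
  measurable_fun [set: simplex R q] (fun x : simplex R q => Phi r (val x) L).
Proof.
apply: measurable_esum => [x i|i].
  by rewrite lee_fin prodr_ge0// => h _; apply: divpow_ge0 => j;
    exact: simplex_ge0.
apply/measurable_EFinP; apply: measurable_prod => h _; exact: measurable_divpow.
Qed.

Lemma measurable_psi (A : multicolor q.+1) :
  measurable_fun [set: simplex R q] (fun x : simplex R q => psi (val x) A).
Proof.
rewrite (_ : (fun _ => _) = (fun x : simplex R q => ((weight A)`!%:R%:E *
    \sum_(m <- [seq m <- vecs q.+1 (weight A) | msubset (dust m) A])
      (divpow (val x 0%N) m)%:E *
        divphi (val x) (msetB A (dust m))))%E); last first.
  by apply/funext => x; rewrite psiE ?big_filter// => i j; exact: simplex_ge0.
apply: measurable_funeM; apply: emeasurable_sum => m.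
apply: emeasurable_funM; first by apply/measurable_EFinP;
  exact: measurable_divpow.
by apply: measurable_funeM; exact: measurable_Phi.
Qed.

End psi_measurable.

(** * Measurability of the lifted degeneracy map *)

Definition at_least (n : nat) (P : pred nat) : Prop :=
  exists s : seq nat, [&& uniq s, size s == n & all P s].

(** The position [sigma i] of the entry of rank [i] depends on the whole sequence,
but its value is the only one with at least [i + 1] entries above it in the weak sense
and at most [i] in the strict sense. This characterization mentions neither [sigma] nor
the ties. *)
Lemma sorted_rank d (K : orderType d) (k : nat -> K) (sigma : nat -> nat) i l :
  bijective sigma -> (forall n, k (sigma n.+1) <= k (sigma n))%O ->
  at_least i.+1 (fun l' => k l <= k l')%O /\
    ~ at_least i.+1 (fun l' => k l < k l')%O
  <-> k l = k (sigma i).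
Proof.
move=> [tau sK tK] ksorted.
have mono : {homo k \o sigma : m n / (m <= n)%N >-> (n <= m)%O}.
  apply: homo_leq => [m|n m r mn nr|n];
    [exact: lexx|exact: le_trans nr mn|exact: ksorted].
have top (P : pred nat) : (forall n, (n <= i)%N -> P (sigma n)) ->
  at_least i.+1 P.
  move=> Ptop; exists (map sigma (iota 0 i.+1)).
  rewrite map_inj_uniq ?iota_uniq ?size_map ?size_iota ?eqxx/=;
    last exact: can_inj sK.
  rewrite -[_ && _]/(all P (map sigma (iota 0 i.+1)));
    apply/allP => _ /mapP[n + ->].
  by rewrite mem_iota ltnS => /Ptop.
have bot (P : pred nat) : (forall n, (i <= n)%N -> ~~ P (sigma n)) ->
  ~ at_least i.+1 P.
  move=> Pbot [s /and3P[us /eqP si /allP sP]].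
  have sub : {subset map tau s <= iota 0 i}.
    move=> _ /mapP[l' /sP Pl' ->]; rewrite mem_iota add0n ltnNge;
      apply/negP => /Pbot.
    by rewrite tK Pl'.
  have ut : uniq (map tau s) by rewrite map_inj_uniq//; exact: can_inj tK.
  by have := uniq_leq_size ut sub; rewrite size_map si size_iota ltnn.
split=> [[ge gt]|ki]; last first.
  split; first by apply: top => n ni; rewrite ki; exact: mono.
  by apply: bot => n ni; rewrite ki -leNgt; exact: mono.
case: (ltgtP (k l) (k (sigma i))) => // kl.
  by exfalso; apply: gt; apply: top => n ni; apply: lt_le_trans kl (mono _ _ ni).
exfalso; apply: bot ge => n ni; rewrite -ltNge.
exact: le_lt_trans (mono _ _ ni) kl.
Qed.

Lemma slkey_inj (V : nmodType) q : injective (@slkey V q).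
Proof.
move=> u v [_ /eq_in_map uv]; apply/rowP => j; apply: uv.
by rewrite mem_enum.
Qed.

Lemma lexi_le_cons d (T : orderType d) (a b : T) s t :
  lexi_le (a :: s) (b :: t) = (a <= b)%O && ((b <= a)%O ==> lexi_le s t).
Proof. by rewrite /lexi_le/= lexi_cons. Qed.

Section measurable_sets.
Context d (T : measurableType d).

Lemma measurable_all (I : eqType) (P : I -> T -> bool) (s : seq I) :
  (forall i, measurable [set x | P i x]) -> measurable [set x | all (P^~ x) s].
Proof.
move=> mP; elim: s => [|i s IH] /=; first by rewrite set_true.
rewrite (_ : [set _ | _] = [set x | P i x] `&` [set x | all (P^~ x) s]);
  first exact: measurableI.
by apply/seteqP; split => x /= => [/andP[]//|[-> ->]].
Qed.

Lemma measurable_exists (I : countType) (P : I -> T -> Prop) :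
  (forall i, measurable [set x | P i x]) -> measurable [set x | exists i, P i x].
Proof.
move=> mP; rewrite (_ : [set _ | _] = \bigcup_i [set x | P i x]).
  exact: countable_bigcupT_measurable.
by apply/seteqP; split => [x [i Pi]|x [i _ Pi]]; exists i.
Qed.

Lemma measurable_at_least n (P : nat -> T -> bool) :
  (forall i, measurable [set x | P i x]) ->
    measurable [set x | at_least n (P^~ x)].
Proof.
move=> mP; rewrite /at_least.
apply: (@measurable_exists _ (fun (s : seq nat) x =>
  [&& uniq s, size s == n & all (P^~ x) s] : Prop)) => s.
case: (uniq s); last by rewrite set_false.
by case: (size s == n); rewrite ?set_false//=; exact: measurable_all.
Qed.

Lemma measurable_lexi_le (R : realType) (fs : seq ((T -> R) * (T -> R))) :
  (forall f, f \in fs -> measurable_fun setT f.1 /\ measurable_fun setT f.2) ->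
  measurable [set x | lexi_le [seq f.1 x | f <- fs] [seq f.2 x | f <- fs]].
Proof.
elim: fs => [|f fs IH] mfs /=; first by rewrite set_true.
have [m1 m2] := mfs f (mem_head _ _).
have mle (a b : T -> R) : measurable_fun setT a -> measurable_fun setT b ->
    measurable [set x | a x <= b x].
  by move=> ma mb; rewrite -[X in measurable X]setTI; exact: measurable_fun_le.
rewrite (_ : [set _ | _] = [set x | f.1 x <= f.2 x] `&`
   (~` [set x | f.2 x <= f.1 x] `|`
    [set x | lexi_le [seq f.1 x | f <- fs] [seq f.2 x | f <- fs]])).
  apply: measurableI; first exact: mle.
  apply: measurableU; first by apply: measurableC; exact: mle.
  by apply: IH => h hfs; apply: mfs; rewrite inE hfs orbT.
apply/seteqP; split => x /=; rewrite lexi_le_cons.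
  by move=> /andP[-> /implyP h]; split => //;
    have [/h|] := boolP (f.2 x <= f.1 x); [right|left; exact/negP].
move=> [-> h]; apply/implyP => fx; by case: h.
Qed.

End measurable_sets.

Section cylinders.
Context (R : realType) (p : nat).

(** Cylinders with rational centres form a countable base of the product topology. *)
Definition cylinder (c : seq (seq rat) * nat) : set (nat -> 'rV[R]_p) :=
  [set y | forall i (j : 'I_p), (i < size c.1)%N ->
    `|y i ord0 j - ratr (nth 0 (nth [::] c.1 i) j)| < c.2.+1%:R^-1].

(** The boxes around [y] generate a filter that converges pointwise to [y], hence
converges to [y] in the product topology, so each neighbourhood of [y] contains a
box. *)
Lemma ptws_nbhs_box (V : set {ptws nat -> 'rV[R]_p}) (y : nat -> 'rV[R]_p) :
  open V -> V y -> exists N (e : R), 0 < e /\ forall z : nat -> 'rV[R]_p,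
    (forall i j, (i < N)%N -> `|y i ord0 j - z i ord0 j| < e) -> V z.
Proof.
move=> oV Vy.
pose box (Ne : nat * R) := [set z : nat -> 'rV[R]_p | forall i j, (i < Ne.1)%N ->
  `|y i ord0 j - z i ord0 j| < Ne.2].
pose F := filter_from [set Ne : nat * R | 0 < Ne.2] box.
have FF : Filter F.
  apply: filter_from_filter; first by exists (0%N, 1) => /=.
  move=> [N e] [M f] /= e0 f0; exists (maxn N M, Num.min e f).
    by rewrite /= lt_min e0 f0.
  move=> z zb; split => i j iN; have /= := zb i j;
    by rewrite leq_max iN ?orbT => /(_ isT); rewrite lt_min => /andP[].
have Fy : {ptws, F --> y}.
  apply/pointwise_cvgP => t; apply/cvg_ballP => e e0.
  exists (t.+1, e) => // z zb; split => // i j.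
  by rewrite (ord1 i); apply: zb.
have [[N e] e0 NeV] : F V by apply: Fy; exact: open_nbhs_nbhs.
by exists N, e; split=> // z zb; apply: NeV.
Qed.

Lemma open_cylinders (V : set {ptws nat -> 'rV[R]_p}) : open V ->
  V = \bigcup_(c in [set c | cylinder c `<=` V]) cylinder c.
Proof.
move=> oV; apply/seteqP; split => [y Vy|y [c cV yc]]; last exact: cV.
have [N [e [e0 eV]]] := ptws_nbhs_box oV Vy.
(* The radius [1 / (k + 1)] is at most [e / 2], because [y] and any other point of
   the cylinder are both that close to its centre. *)
pose k := Num.truncn (2 / e).
have k0 : 0 < k.+1%:R^-1 :> R by rewrite invr_gt0.
have ke : k.+1%:R^-1 + k.+1%:R^-1 <= e.
  have h : 2 / e < k.+1%:R by exact: truncnS_gt.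
  rewrite -mulr2n -[leLHS]mulr_natr ler_pdivrMl// -ler_pdivrMr//.
  exact: ltW.
have /choice[r rP] : forall ij : nat * 'I_p, exists r : rat,
    `|y ij.1 ord0 ij.2 - ratr r| < k.+1%:R^-1.
  move=> [i j] /=.
  have : y i ord0 j - k.+1%:R^-1 < y i ord0 j + k.+1%:R^-1.
    by rewrite ltrBlDr -addrA ltrDl addr_gt0.
  move=> /rat_in_itvoo[r]; rewrite in_itv /= => /andP[r1 r2]; exists r.
  by rewrite ltr_distlC r1 r2.
pose s := mkseq (fun i => [seq r (i, j) | j <- enum 'I_p]) N.
have sE i (j : 'I_p) : (i < N)%N -> nth 0 (nth [::] s i) j = r (i, j).
  move=> iN; rewrite nth_mkseq// (nth_map j) ?size_enum_ord//.
  by rewrite nth_ord_enum.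
exists (s, k); last first.
  by move=> i j /=; rewrite size_mkseq => iN; rewrite sE//; exact: (rP (i, j)).
move=> z /= zs; apply: eV => i j iN.
have := zs i j; rewrite /= size_mkseq sE// => /(_ iN) zr.
apply: lt_le_trans ke.
rewrite -(subrK (ratr (r (i, j))) (y i ord0 j)) -addrA.
apply: le_lt_trans (ler_normD _ _) _; apply: ltrD; first exact: (rP (i, j)).
by rewrite distrC.
Qed.

Lemma measurable_preimage_ptws d (T : measurableType d) (F : T -> nat -> 'rV[R]_p)
    (V : set {ptws nat -> 'rV[R]_p}) :
  (forall i j, measurable_fun setT (fun x => F x i ord0 j)) ->
  open V -> measurable (F @^-1` V).
Proof.
move=> mF /open_cylinders ->.
rewrite (_ : _ @^-1` _ = [set x |
    exists c, cylinder c `<=` V /\ cylinder c (F x)]).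
  apply: (@measurable_exists _ _ _
    (fun c x => cylinder c `<=` V /\ cylinder c (F x))) => c.
  have [cV|cV] := pselect (cylinder c `<=` V); last first.
    by rewrite (_ : [set _ | _] = set0)//; apply/seteqP; split => x // [].
  rewrite (_ : [set _ | _] = [set x | all (fun i => all (fun j : 'I_p =>
      `|F x i ord0 j - ratr (nth 0 (nth [::] c.1 i) j)| < c.2.+1%:R^-1)
        (enum 'I_p)) (iota 0 (size c.1))]); last first.
    apply/seteqP; split => x /=.
      move=> [_ xc]; apply/allP => i; rewrite mem_iota => /= ic.
      by apply/allP => j _; exact: xc.
    move=> /allP xc; split=> // i j ic; have := xc i; rewrite mem_iota => /(_ ic).
    by move=> /allP; apply; rewrite mem_enum.
  apply: (@measurable_all _ _ _ (fun i x => all (fun j : 'I_p =>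
      `|F x i ord0 j - ratr (nth 0 (nth [::] c.1 i) j)| < c.2.+1%:R^-1)
        (enum 'I_p))) => i.
  apply: (@measurable_all _ _ _ (fun (j : 'I_p) x =>
      `|F x i ord0 j - ratr (nth 0 (nth [::] c.1 i) j)| < c.2.+1%:R^-1)) => j.
  set r := ratr _; set e := _^-1.
  rewrite (_ : [set _ | _] = ~` [set x | e <= `|F x i ord0 j - r|]); last first.
    by apply/seteqP; split => x /=; rewrite real_ltNge ?num_real// => /negP.
  apply: measurableC; rewrite -[X in measurable X]setTI;
    apply: measurable_fun_le => //.
  by apply: measurableT_comp => //; apply: measurable_funB => //.
by apply/seteqP; split => x /= [c]; [move=> cV xc|move=> [cV xc]]; exists c.
Qed.

End cylinders.

Section lift_deg.
Context (R : realType) (q p : nat) (g : 'I_q.+1 -> 'I_p.+1).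

Lemma lift_degP (x : simplex R q) : is_lift g (val x) (val (lift_deg g x)).
Proof. by rewrite /lift_deg; case: cid. Qed.

Lemma measurable_g_sharp i k : measurable_fun [set: simplex R q]
  (fun x : simplex R q => g_sharp g (val x i) ord0 k).
Proof.
under eq_fun do rewrite mxE -big_filter.
by apply: measurable_sum => j; exact: measurable_simplex_coord.
Qed.

Let key l (x : simplex R q) : seqlexi R := slkey (g_sharp g (val x l.+1)).

Lemma measurable_key_le l m : measurable [set x | (key l x <= key m x)%O].
Proof.
pose f k := ((fun x : simplex R q => g_sharp g (val x l.+1) ord0 k),
             (fun x : simplex R q => g_sharp g (val x m.+1) ord0 k)).
pose fs := ((fun x : simplex R q => vnorm (g_sharp g (val x l.+1))),
            (fun x : simplex R q => vnorm (g_sharp g (val x m.+1)))) ::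
           [seq f k | k <- enum 'I_p.+1].
have e1 x : [seq h.1 x | h <- fs] = slkey (g_sharp g (val x l.+1)).
  by rewrite /fs map_cons -map_comp.
have e2 x : [seq h.2 x | h <- fs] = slkey (g_sharp g (val x m.+1)).
  by rewrite /fs map_cons -map_comp.
have e x : (key l x <= key m x)%O =
    lexi_le [seq h.1 x | h <- fs] [seq h.2 x | h <- fs].
  by rewrite e1 e2.
under eq_set do rewrite e.
apply: measurable_lexi_le => h; rewrite inE => /orP[/eqP ->|/mapP[k _ ->]] /=.
  by split; apply: measurable_sum => k; exact: measurable_g_sharp.
by split; exact: measurable_g_sharp.
Qed.

(** The choice of a rearrangement in [lift_deg] is not explicit, but its entries are
characterized by [sorted_rank], whatever the choice. *)
Lemma measurable_lift_coord i k : measurable_fun [set: simplex R q]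
  (fun x : simplex R q => val (lift_deg g x) i ord0 k).
Proof.
case: i => [|i].
  rewrite (_ : (fun _ => _) =
    (fun x : simplex R q => g_sharp g (val x 0%N) ord0 k)).
    exact: measurable_g_sharp.
  by apply/funext => x; have [-> _] := lift_degP x.
move=> _ E mE; rewrite setTI.
pose sel l x := at_least i.+1 (fun l' => key l x <= key l' x)%O /\
              ~ at_least i.+1 (fun l' => key l x < key l' x)%O.
rewrite (_ : _ @^-1` _ = [set x | exists l,
    E (g_sharp g (val x l.+1) ord0 k) /\ sel l x]).
  apply: (@measurable_exists _ (simplex R q) nat (fun l x =>
    E (g_sharp g (val x l.+1) ord0 k) /\ sel l x)) => l.
  apply: measurableI.
    rewrite -[X in measurable X]setTI; exact: measurable_g_sharp.
  apply: measurableI.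
    by apply: (@measurable_at_least _ _ _
      (fun l' x => (key l x <= key l' x)%O)) => l';
      exact: measurable_key_le.
  apply: measurableC.
  apply: (@measurable_at_least _ _ _ (fun l' x => (key l x < key l' x)%O)) => l'.
  rewrite (_ : [set _ | _] = ~` [set x | (key l' x <= key l x)%O]).
    by apply: measurableC; exact: measurable_key_le.
  by apply/seteqP; split => x /=; rewrite ltNge => /negP.
have selP x l : sel l x <->
    g_sharp g (val x l.+1) = val (lift_deg g x) i.+1.
  have [_ [sigma sbij sE]] := lift_degP x.
  have sorted n : (key (sigma n.+1) x <= key (sigma n) x)%O.
    have := lift_deg g x; have : kingman_simplex R p.+1 (val (lift_deg g x)).
      by case: (lift_deg g x) => y /=; rewrite inE.
    by move=> [_ /(_ n) + _] _; rewrite !sE.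
  rewrite sE; split=> [/(sorted_rank (k := key^~ x) i l sbij sorted)|e].
    exact: slkey_inj.
  by apply/(sorted_rank (k := key^~ x) i l sbij sorted); rewrite /key e.
apply/seteqP; split => x /=; last by move=> [l [El /selP <-]].
have [_ [sigma sbij sE]] := lift_degP x.
by move=> Ex; exists (sigma i); rewrite selP -sE.
Qed.

Lemma measurable_lift_deg : measurable_fun [set: simplex R q] (@lift_deg R q p g).
Proof.
apply: (@measurability _ _ _ (simplex R p) _ _ (@open (simplex R p))) => //.
move=> _ [_ [V oV <-] <-]; rewrite setTI.
exact: (measurable_preimage_ptws measurable_lift_coord oV).
Qed.

End lift_deg.

(** * Merging of represented structures *)

(** Integrate [psi_law_lift] with respect to [mu]. *)
Lemma represents_lift_deg (R : realType) q p (g : 'I_q.+1 -> 'I_p.+1)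
    (P : forall n : nat, probability (chrom q.+1 n) R)
    (mu : probability (simplex R q) R) :
  represents mu P -> represents (pushforward mu (lift_deg g)) (gdeg_push g P).
Proof.
move=> muP n B.
rewrite ge0_integral_pushforward//; last 3 first.
- exact: measurable_lift_deg.
- exact: measurable_psi.
- by move=> y _; apply: psi_ge0 => i j; exact: simplex_ge0.
rewrite preimage_setT.
have E (x : simplex R q) : psi (val (lift_deg g x)) (val B) =
    (\sum_(A \in @gdeg q.+1 p.+1 g n @^-1` [set B]) psi (val x) (val A))%E.
  have := congr1 (fun law => law [set B]) (psi_law_lift g x n).
  by rewrite /pushforward /psi_law fsbig_set1 => ->.
under eq_integral => x _ do rewrite /= E.
rewrite ge0_integral_fsum//; last 3 first.
- by move=> A; exact: measurable_psi.
- by move=> A x _; apply: psi_ge0 => i j; exact: simplex_ge0.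
- exact: sub_finite_set (finite_chromT q.+1 n).
rewrite [LHS]/= /gdeg_push /distribution /pushforward probability_chrom.
by apply: eq_fsbigr => A _; exact: muP.
Qed.

Theorem proposition5p37 (R : realType) (p q : nat) (pq : (p.+1 <= q.+1)%N)
    (g : 'I_q.+1 -> 'I_p.+1) (g_surj : forall k, exists j, g j = k) :
  [/\ forall (P : forall n : nat, probability (chrom q.+1 n) R)
             (mu : probability (simplex R q) R),
        partition_structure P -> represents mu P ->
        [/\ partition_structure (gdeg_push g P),
            measurable_fun [set: simplex R q] (lift_deg g) &
            represents (pushforward mu (lift_deg g)) (gdeg_push g P)],
      forall P : forall n : nat, probability (chrom q.+1 n) R,
        extremal P -> extremal (gdeg_push g P) &
      forall (x : simplex R q) (n : nat),
        pushforward (psi_law x (n := n)) (@gdeg q.+1 p.+1 g n)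
        = psi_law (lift_deg g x) (n := n)].
Proof.
split=> [P mu PS muP|P|x n].
- split; first exact: partition_structure_gdeg_push.
  + exact: measurable_lift_deg.
  + exact: represents_lift_deg.
- exact: extremal_gdeg_push.
- exact: psi_law_lift.
Qed.
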